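(* Let $p > 2$ be a prime, let $G = \mathrm{PSL}_2(p)$ and let $A$ be a maximal coclique in $G$. Then at least one of the following holds: (i) $A$ is a maximal subgroup of $G$; (ii) $A \setminus \{1\}$ is the conjugacy class of all involutions of $G$; (iii) $|A| \leq \frac{129}{2}(p-1) + 2$.
   Context: For a group $G$, a subset $A \subseteq G$ is a coclique if $\langle g, h\rangle \neq G$ for all $g, h \in A$. A coclique $A$ is maximal if, whenever $B \subseteq G$ is a coclique with $A \subseteq B$, one has $A = B$. An involution is an element of order $2$. *)

(* Defs.v *)
From HB Require Import structures.
From mathcomp Require Import all_boot all_order all_algebra all_fingroup.
From mathcomp Require Import all_solvable.

Set Implicit Arguments.
Unset Strict Implicit.
Unset Printing Implicit Defensive.

Import GroupScope GRing.Theory.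

Definition SL2 (F : finFieldType) : {set {'GL_2[F]}} :=
  [set u : {'GL_2[F]} | (\det (GLval u) == 1)%R].

Lemma SL2_group_set (F : finFieldType) : group_set (SL2 F).
Proof.
apply/group_setP; split=> [|u v]; first by rewrite inE GL_1E det1.
rewrite !inE => /eqP du /eqP dv.
by rewrite GL_MxE det_mulmx du dv mulr1.
Qed.

Canonical SL2_group (F : finFieldType) : {group {'GL_2[F]}} :=
  Group (SL2_group_set F).

(* The type coset_of 'Z(SL2 F) contains all cosets of the centre in its
   normaliser in GL_2(F), so PSL2 F is in general a proper subset of it. *)
Definition PSL2 (F : finFieldType) : {group coset_of 'Z(SL2 F)} :=
  (SL2 F / 'Z(SL2 F))%G.

Definition coclique (gT : finGroupType) (G A : {set gT}) : Prop :=
  A \subset G /\ {in A &, forall g h, <<[set g; h]>> <> G}.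

Definition maximal_coclique (gT : finGroupType) (G A : {set gT}) : Prop :=
  coclique G A /\ forall B : {set gT}, coclique G B -> A \subset B -> A = B.

(* Main.v *)
Require Import Defs.
From mathcomp Require Import all_boot all_order all_algebra all_fingroup.
From mathcomp Require Import all_solvable.
From mathcomp Require Import ring lra zify.

(** The proof works with the set [E] of matrices of determinant 1 over 'F_p whose
    classes modulo the centre lie in the coclique [A]. It has twice the size of
    [A], and any two of its members generate, together with -1, a proper subgroup
    of SL2(p). No list of the subgroups of PSL2(p) enters; three facts suffice.

    First, since p is prime, two transvections with different eigenlines generate
    SL2(p) ([parabolic_generation]). Hence if [A] has an element of order p, all of
    [A] fixes the eigenline of this element, and [A], being maximal, is a Borel
    subgroup ([borel_maximal]).

    Secondly, let [H] be a proper subgroup of SL2(p) without elements of order p.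
    Its noncentral elements are partitioned by their centralisers, which are
    abelian and of index at most 2 in their normalisers. Counting conjugacy classes
    of centralisers, as for the finite rotation groups, shows that a centraliser of
    order at least 6 modulo the centre has index at most 2 in [H]
    ([centralizer_dichotomy]). So if [x] and [y] generate a proper subgroup and
    [\tr x] is not 0, then [x] and [y] have a common eigenline, or they commute, or
    [\tr y = \tr (x y) = 0], or all the elements of the subgroup have order at most
    5 modulo the centre; in the last case [\tr x], [\tr y] and [\tr (x y)] belong to
    a set of at most 9 values ([proper_pair_linked]).

    Thirdly, for a fixed noncentral [Z], the matrices [Y] of determinant 1 with given
    values of [\tr Y] and [\tr (Z Y)] form a conic in an affine plane, so there are
    about p of them ([card_anisotropic_conic] when [Z] has no eigenline).

    If [E] has a member [Z] of order at least 3 modulo the centre, these facts bound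
    [E]. When [Z] has no eigenline, [E] is covered by the centraliser of [Z] and
    by at most 81 conics ([card_elliptic_linked]). When [Z] is diagonal, the two
    Borel subgroups containing [Z] also contribute: either [E] lies in one of them
    and [A] is this Borel subgroup modulo the centre, or each of them is tested
    against a member of [E] outside of it and contributes at most [21 (p - 1)] elements
    besides the diagonal ones, for a total of at most [124 (p - 1)]
    ([card_hyperbolic_linked]). Finally, if all members of [A] have order at most 2,
    then [A] consists of 1 and all involutions, since two involutions never
    generate PSL2(p) ([square_central_coclique]). *)

Import GroupScope GRing.Theory.
Set Implicit Arguments.
Unset Strict Implicit.
Unset Printing Implicit Defensive.

(** * Centralisers of noncentral elements *)

(** Here [h] is the order of a group modulo its centre and [k] the number of
    nontrivial elements modulo the centre that lie in the conjugates of a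
    centraliser of order [c], which has index [f] in its normaliser. The ratio
    [k / h = (1 - 1 / c) / f] is 1/4, or at least 1/3, and it lies in none of the
    gaps ]1/4, 1/3[ and ]1/2, 2/3[. *)
Lemma orbit_size_arith (c f n h : nat) (k := ((c - 1) * n)%N) :
    1 < c -> 0 < f -> f <= 2 -> 0 < n -> (c * (f * n) = h)%N ->
  [/\ h <= 4 * k, 4 * k = h \/ h <= 3 * k & 2 * k <= h \/ 2 * h <= 3 * k]%N.
Proof.
move=> c1 f0 f2 n0; rewrite /k => <-.
have [-> | ->] : f = 1%N \/ f = 2%N by lia.
- have [-> | c3] : c = 2%N \/ 2 < c by lia.
    by split; lia.
  by split; [nia | right; nia | right; nia].
- have [-> | c3] : c = 2%N \/ 2 < c by lia.
    by split; lia.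
  by split; [nia | right; nia | left; nia].
Qed.

(** The centralisers [C] partition the noncentral elements of [H]. Modulo [Z], a
    conjugacy class of centralisers of order [c] covers the fraction
    [(1 - 1 / c) / f] of the group, with [f] = 1 or 2 the index of [C] in its
    normaliser, and these fractions add up to [1 - 1 / #|H : Z|]. If
    [c >= 6] and [#|H : C| > 2], then the class of [C] leaves a fraction in
    ]1/2, 7/12[ if [f] = 2, and one that is positive but below 1/6 if [f] = 1.
    The values allowed by [orbit_size_arith] cannot add up to that: one of them is at
    least 1/4, and it is at most 1/2 or at least 2/3; two of them make 1/2 or at
    least 7/12; three make at least 3/4. This is the count by which the finite
    rotation groups are classified. *)
Lemma centralizer_dichotomy (gT : finGroupType) (H Z : {group gT}) :
    Z \subset H -> H \subset 'C(Z) ->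
    {in H :\: Z, forall x, abelian 'C_H[x]} ->
    {in H :\: Z, forall x, #|'N_H('C_H[x]) : 'C_H[x]| <= 2} ->
  {in H :\: Z, forall x, #|'C_H[x] : Z| <= 5 \/ #|H : 'C_H[x]| <= 2}.
Proof.
move=> sZH cHZ abC nC.
have sZC x : x \in H -> Z \subset 'C_H[x].
  move=> Hx; rewrite subsetI sZH; apply/subsetP=> z Zz; apply/cent1P.
  exact: commute_sym (centsP cHZ x Hx z Zz).
have eqC x y : x \in H :\: Z -> y \in 'C_H[x] :\: Z -> 'C_H[y] = 'C_H[x].
  move=> HZx /setDP[Cxy nZy]; have [Hx nZx] := setDP HZx.
  have [Hy cxy] := setIP Cxy.
  have HZy : y \in H :\: Z by rewrite inE nZy.
  apply/eqP; rewrite eqEsubset; apply/andP; split.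
    rewrite subsetI subsetIl /= -(cent_set1 x) centsC sub1set.
    have := abC _ HZy; rewrite /abelian => /subsetP; apply.
    by rewrite inE Hx cent1C.
  rewrite subsetI subsetIl /= -(cent_set1 y) centsC sub1set.
  by have := abC _ HZx; rewrite /abelian => /subsetP; apply.
pose K x := class_support ('C_H[x] :\: Z) H.
have memC x : x \in H :\: Z -> x \in 'C_H[x] :\: Z.
  case/setDP=> Hx nZx; apply/setDP; split=> //; apply/setIP.
  by split=> //; exact: cent1id.
have nZH : H \subset 'N(Z) by rewrite (subset_trans cHZ) ?cent_sub.
have ti x : x \in H :\: Z -> normedTI ('C_H[x] :\: Z) H 'N_H('C_H[x]).
  move=> HZx; have Cx := memC _ HZx; apply/normedTI_P; split.
  - by apply/set0Pn; exists x.
  - rewrite subsetI subsetIl /=; apply/subsetP=> g /setIP[Hg nCg].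
    by rewrite inE conjDg (normP nCg) (normP (subsetP nZH g Hg)).
  move=> g Hg; rewrite -setI_eq0 => /set0Pn[a /setIP[Ca]].
  rewrite mem_conjg => Cb; rewrite inE Hg inE.
  have conjE : 'C_H[a ^ g^-1] :^ g = 'C_H[a].
    by rewrite conjIg -normJ conjg_set1 conjgKV conjGid.
  by rewrite -{1}(eqC _ _ HZx Cb) conjE (eqC _ _ HZx Ca) subxx.
have cardK x : x \in H :\: Z ->
   let c := #|'C_H[x] : Z| in let f := #|'N_H('C_H[x]) : 'C_H[x]| in
   let n := #|H : 'N_H('C_H[x])| in
   [/\ #|K x| = (#|Z| * ((c - 1) * n))%N, 1 < c, 0 < f <= 2, 0 < n
     & (c * (f * n))%N = #|H : Z| /\ (f * n)%N = #|H : 'C_H[x]|].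
  move=> HZx c f n; have [Hx nZx] := setDP HZx.
  have sCN : 'C_H[x] \subset 'N_H('C_H[x]) by rewrite subsetI subsetIl normG.
  have cE : #|'C_H[x]| = (#|Z| * c)%N by rewrite Lagrange ?sZC.
  split; rewrite ?indexg_gt0 ?nC //.
  - rewrite (card_support_normedTI (ti x HZx)) cardsD (setIidPr (sZC _ Hx)) cE.
    by rewrite -/n mulnA mulnBr muln1.
  - rewrite indexg_gt1; apply/subsetPn; exists x => //.
    by case/setDP: (memC _ HZx).
  have fn : (f * n)%N = #|H : 'C_H[x]| by rewrite mulnC Lagrange_index ?subsetIl.
  split=> //; rewrite fn mulnC Lagrange_index ?subsetIl ?sZC //.
have KH x : x \in H :\: Z -> K x \subset H :\: Z.
  move=> _; apply/subsetP=> _ /imset2P[b g /setDP[/setIP[Hb _] nZb] Hg ->].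
  by apply/setDP; rewrite groupJ // memJ_norm ?(subsetP nZH g Hg).
have KK x y : x \in H :\: Z -> y \in H :\: Z -> y \notin K x ->
    [disjoint K x & K y].
  move=> HZx HZy; apply: contraR; rewrite -setI_eq0 => /set0Pn[a /setIP[]].
  case/imset2P=> b g Cb Hg -> /imset2P[b' g' Cb' Hg' e].
  have Eb : b' = b ^ (g * g'^-1) by rewrite conjgM e conjgK.
  have : 'C_H[y] = 'C_H[x] :^ (g * g'^-1).
    rewrite -(eqC _ _ HZy Cb') -(eqC _ _ HZx Cb) Eb conjIg -normJ conjg_set1.
    by rewrite conjGid ?groupM ?groupV.
  move=> EC; have := memC _ HZy; rewrite EC.
  case/setDP=> /imsetP[x' Cx' Ey] nZy.
  rewrite Ey; apply: memJ_class_support; rewrite ?groupM ?groupV //.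
  apply/setDP; split=> //; apply: contra nZy => Zx'.
  by rewrite Ey memJ_norm // (subsetP nZH) ?groupM ?groupV.
have Zpos : 0 < #|Z| by [].
have cardHZ : #|H :\: Z| = (#|Z| * (#|H : Z| - 1))%N.
  by rewrite cardsD (setIidPr sZH) -(Lagrange sZH) mulnBr muln1.
have ex (U : {set gT}) : U \subset H :\: Z -> #|U| < #|H :\: Z| ->
    exists2 y, y \in H :\: Z & y \notin U.
  move=> sU ltU; apply/subsetPn; apply: contraL ltU => s; rewrite -leqNgt.
  exact: subset_leq_card.
pose k x := ((#|'C_H[x] : Z| - 1) * #|H : 'N_H('C_H[x])|)%N.
have kP x : x \in H :\: Z -> [/\ #|H : Z| <= 4 * k x,
     4 * k x = #|H : Z| \/ #|H : Z| <= 3 * k x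
     & 2 * k x <= #|H : Z| \/ 2 * #|H : Z| <= 3 * k x]%N.
  case/cardK=> _ c1 /andP[f0 f2] n0 [e _].
  exact: (orbit_size_arith c1 f0 f2 n0 e).
have Kk x : x \in H :\: Z -> #|K x| = (#|Z| * k x)%N by case/cardK.
have cU (U V : {set gT}) : [disjoint U & V] -> #|U :|: V| = (#|U| + #|V|)%N.
  rewrite -(geq_leqif (leq_card_setU U V)) => le.
  by apply/eqP; rewrite eqn_leq le leq_card_setU.
move=> x1 H1.
case: (leqP #|'C_H[x1] : Z| 5) => [|c6]; first by left.
case: (leqP #|H : 'C_H[x1]| 2) => [|i3]; first by right.
have [_ _ /andP[f0 f2] n0 [e1 e2]] := cardK _ H1.
set h := #|H : Z| in cardHZ kP e1.
set c := #|'C_H[x1] : Z| in c6 e1.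
set n := #|H : 'N_H('C_H[x1])| in n0 e1 e2.
set f := #|'N_H('C_H[x1]) : 'C_H[x1]| in f0 f2 e1 e2.
have k1 : k x1 = ((c - 1) * n)%N by [].
exfalso.
(* Elements outside of all the classes found so far are chosen as long as these
   classes, which are disjoint, do not fill [H :\: Z]. *)
have fcase : f = 1%N \/ f = 2%N by lia.
have hc : (6 * (f * n) <= h)%N by rewrite -e1; nia.
have hk : (f * k x1 + f * n = h)%N by rewrite k1 -e1; nia.
have [x2 H2 n2] : exists2 y, y \in H :\: Z & y \notin K x1.
  apply: ex; rewrite ?KH // Kk // cardHZ ltn_pmul2l //.
  by case: fcase hc hk e2 i3 => ->; lia.
have [p2a p2b p2c] := kP _ H2.
have D12 : #|K x1 :|: K x2| = (#|Z| * (k x1 + k x2))%N.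
  by rewrite cU ?KK ?Kk // mulnDr.
have sub12 : K x1 :|: K x2 \subset H :\: Z by rewrite subUset !KH.
have le12 : (k x1 + k x2 <= h - 1)%N.
  by rewrite -(leq_pmul2l Zpos) -cardHZ -D12 subset_leq_card.
have [f2' p2c'] : f = 2%N /\ (2 * k x2 <= h)%N.
  move: fcase hc hk e2 i3 le12 p2a p2c.
  move: (k x1) (k x2) (#|H : 'C_H[x1]|) => a1 a2 i; clear.
  by case=> -> *; lia.
rewrite {}f2' in fcase hc hk e2 i3.
have [x3 H3 n3] : exists2 y, y \in H :\: Z & y \notin K x1 :|: K x2.
  by apply: ex; rewrite // D12 cardHZ ltn_pmul2l //; lia.
have [p3a p3b p3c] := kP _ H3.
move: n3; rewrite inE negb_or => /andP[n13 n23].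
have D123 : #|K x1 :|: K x2 :|: K x3| = (#|Z| * (k x1 + k x2 + k x3))%N.
  rewrite cU ?Kk ?D12 -?mulnDr //.
  by rewrite -setI_eq0 setIUl setU_eq0 !setI_eq0 !KK.
have sub123 : K x1 :|: K x2 :|: K x3 \subset H :\: Z by rewrite subUset sub12 KH.
have le123 : (k x1 + k x2 + k x3 <= h - 1)%N.
  by rewrite -(leq_pmul2l Zpos) -cardHZ -D123 subset_leq_card.
have [q2 q3] : (4 * k x2 = h /\ 4 * k x3 = h)%N.
  move: hc hk e2 i3 le123 p2a p2b p3a p3b.
  move: (k x1) (k x2) (k x3) (#|H : 'C_H[x1]|) => a1 a2 a3 i; clear => *.
  by lia.
have [x4 H4 n4] : exists2 y, y \in H :\: Z & y \notin K x1 :|: K x2 :|: K x3.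
  by apply: ex; rewrite // D123 cardHZ ltn_pmul2l //; lia.
have [p4a _ _] := kP _ H4.
move: n4; rewrite !inE !negb_or -andbA => /and3P[n14 n24 n34].
have : (k x1 + k x2 + k x3 + k x4 <= h - 1)%N.
  rewrite -(leq_pmul2l Zpos) -cardHZ mulnDr -D123 -Kk //.
  rewrite -cU; first by rewrite subset_leq_card // subUset sub123 KH.
  by rewrite -setI_eq0 !setIUl !setU_eq0 !setI_eq0 !KK.
move: hc hk e2 i3 q2 q3 p4a.
move: (k x1) (k x2) (k x3) (k x4) (#|H : 'C_H[x1]|) => a1 a2 a3 a4 i; clear.
by lia.
Qed.

(** * Two by two matrices *)

Local Open Scope ring_scope.

(** Equations are proved below as explicit linear combinations, with
    coefficients [k], [k'], [k''], of known ones. *)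
Lemma lin1 (R : comPzRingType) (k a b l r : R) :
  l = r -> a - b = k * (l - r) -> a = b.
Proof. by move=> -> e; apply: subr0_eq; rewrite e subrr mulr0. Qed.

Lemma lin2 (R : comPzRingType) (k k' a b l r l' r' : R) :
  l = r -> l' = r' -> a - b = k * (l - r) + k' * (l' - r') -> a = b.
Proof. by move=> -> -> e; apply: subr0_eq; rewrite e !subrr !mulr0 !addr0. Qed.

Lemma lin3 (R : comPzRingType) (k k' k'' a b l r l' r' l'' r'' : R) :
    l = r -> l' = r' -> l'' = r'' ->
  a - b = k * (l - r) + k' * (l' - r') + k'' * (l'' - r'') -> a = b.
Proof. by move=> -> -> -> e; apply: subr0_eq; rewrite e !subrr !mulr0 !addr0. Qed.

Lemma ord2P (i : 'I_2) : i = 0 \/ i = 1.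
Proof. by case: i => [[|[|]]] //= lt; [left | right]; apply: val_inj. Qed.

Lemma mulmx2E (R : comPzRingType) (m : nat) (A : 'M[R]_(m, 2)) (B : 'M[R]_2) i j :
  (A *m B) i j = A i 0 * B 0 j + A i 1 * B 1 j.
Proof.
rewrite mxE !big_ord_recl big_ord0 addr0.
by congr (A i _ * B _ j + A i _ * B _ j); apply: val_inj.
Qed.

Lemma mxtrace2E (R : comPzRingType) (A : 'M[R]_2) : \tr A = A 0 0 + A 1 1.
Proof.
rewrite /mxtrace !big_ord_recl big_ord0 addr0.
by congr (A _ _ + A _ _); apply: val_inj.
Qed.

Lemma det2E (R : comNzRingType) (A : 'M[R]_2) :
  \det A = A 0 0 * A 1 1 - A 0 1 * A 1 0.
Proof.
rewrite (expand_det_row _ 0) !big_ord_recl big_ord0 addr0 /cofactor !det_mx11 !mxE /=.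
have l0 : lift 0 0 = 1 :> 'I_2 by apply: val_inj.
have l1 : lift 1 0 = 0 :> 'I_2 by apply: val_inj.
by rewrite !l0 !l1 /= expr0 expr1 mul1r mulN1r mulrN.
Qed.

Lemma eq_mx2 (R : Type) (A B : 'M[R]_2) :
  A 0 0 = B 0 0 -> A 0 1 = B 0 1 -> A 1 0 = B 1 0 -> A 1 1 = B 1 1 -> A = B.
Proof.
by move=> *; apply/matrixP=> i j; case: (ord2P i) => ->; case: (ord2P j) => ->.
Qed.

Definition mx2 (R : Type) (a b c d : R) : 'M[R]_2 :=
  \matrix_(i, j) if i == 0 then if j == 0 then a else b
                 else if j == 0 then c else d.

Lemma mx2_eta (R : Type) (A : 'M[R]_2) : A = mx2 (A 0 0) (A 0 1) (A 1 0) (A 1 1).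
Proof. by apply: eq_mx2; rewrite [RHS]mxE. Qed.

Definition mx2E := (mulmx2E, mxtrace2E, det2E, mxE).

Lemma scalar_mx2E (R : comNzRingType) (A : 'M[R]_2) :
  is_scalar_mx A = [&& A 0 1 == 0, A 1 0 == 0 & A 0 0 == A 1 1].
Proof.
apply/is_scalar_mxP/and3P => [[a ->]|[/eqP b0 /eqP c0 /eqP ad]].
  by rewrite !mxE /= !mulr0n eqxx.
by exists (A 0 0); apply: eq_mx2; rewrite !mxE /= ?mulr1n ?mulr0n.
Qed.

Lemma sqr_mx2 (R : comNzRingType) (A : 'M[R]_2) :
  A *m A = \tr A *: A - (\det A)%:M.
Proof. by apply: eq_mx2; rewrite !mx2E /= ?mulr1n ?mulr0n; ring. Qed.

(** A nonscalar 2 x 2 matrix is cyclic, so it commutes only with its own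
    polynomials, which by Cayley-Hamilton have degree at most 1. *)
Lemma comm_mx2P (F : fieldType) (A B : 'M[F]_2) :
    ~~ is_scalar_mx A -> A *m B = B *m A ->
  exists x y, B = x%:M + y *: A.
Proof.
move=> nsA cAB.
have eq i j : (A *m B) i j = (B *m A) i j by rewrite cAB.
have e00 := eq 0 0; have e01 := eq 0 1; have e10 := eq 1 0; have e11 := eq 1 1.
rewrite !mx2E in e00 e01 e10 e11.
suff [y [h1 h2 h3]] : exists y, [/\ B 0 1 = y * A 0 1, B 1 0 = y * A 1 0
    & B 1 1 - B 0 0 = y * (A 1 1 - A 0 0)].
  exists (B 0 0 - y * A 0 0), y.
  apply: eq_mx2; rewrite !mx2E /= ?mulr1n ?mulr0n ?h1 ?h2 ?add0r //.
  - by ring.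
  - by rewrite -[LHS](subrK (B 0 0)) h3; ring.
move: nsA; rewrite scalar_mx2E !negb_and => /or3P[b0|c0|ad].
- exists (B 0 1 / A 0 1); split; apply: (mulIf b0); rewrite mulrAC divfK //.
  + by apply: (lin1 (k := 1) e00); ring.
  + by apply: (lin1 (k := 1) e01); ring.
- exists (B 1 0 / A 1 0); split; apply: (mulIf c0); rewrite mulrAC divfK //.
  + by apply: (lin1 (k := -1) e00); ring.
  + by apply: (lin1 (k := -1) e10); ring.
- have ad' : A 1 1 - A 0 0 != 0 by rewrite subr_eq0 eq_sym.
  exists ((B 1 1 - B 0 0) / (A 1 1 - A 0 0)).
  split; apply: (mulIf ad'); rewrite mulrAC divfK //.
  + by apply: (lin1 (k := -1) e01); ring.
  + by apply: (lin1 (k := 1) e10); ring.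
Qed.

Lemma eq_rV2 (R : Type) (v w : 'rV[R]_2) :
  v 0 0 = w 0 0 -> v 0 1 = w 0 1 -> v = w.
Proof. by move=> *; apply/rowP=> j; case: (ord2P j) => ->. Qed.

Lemma rV2_neq0 (R : nmodType) (v : 'rV[R]_2) :
  (v != 0) = (v 0 0 != 0) || (v 0 1 != 0).
Proof.
rewrite -negb_and; congr (~~ _); apply/eqP/andP=> [-> | [/eqP v0 /eqP v1]].
  by rewrite !mxE.
by apply: eq_rV2; rewrite mxE.
Qed.

Lemma rV2_colinearP (F : fieldType) (v w : 'rV[F]_2) : v != 0 ->
  (w <= v)%MS <-> v 0 0 * w 0 1 = v 0 1 * w 0 0.
Proof.
move=> nzv; split=> [/sub_rVP[a ->]|e].
  by rewrite !mxE; ring.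
move: nzv; rewrite rV2_neq0 => /orP[v0|v1]; apply/sub_rVP.
  exists (w 0 0 / v 0 0); apply: eq_rV2; rewrite mxE; first by rewrite divfK.
  by apply: (mulfI v0); rewrite e; field.
exists (w 0 1 / v 0 1); apply: eq_rV2; rewrite mxE; last by rewrite divfK.
by apply: (mulfI v1); rewrite -e; field.
Qed.

Lemma det_col_rV2 (F : fieldType) (v w : 'rV[F]_2) : v != 0 ->
  ~~ (w <= v)%MS -> mx2 (v 0 0) (v 0 1) (w 0 0) (w 0 1) \in unitmx.
Proof.
move=> nzv; apply: contraR; rewrite unitmxE unitfE negbK det2E !mxE /=.
by rewrite subr_eq0 => /eqP e; apply/(rV2_colinearP w nzv).
Qed.

(** * Generation by two transvections *)

(** For det [u] = 1 and trace [t], [t ^+ 2 = 4] says that the two eigenvalues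
    agree, so that a nonscalar [u] is conjugate to [t / 2] times a
    transvection. *)
Lemma parabolic_eigenline (F : fieldType) (u : 'M[F]_2) :
    2%:R != 0 :> F -> \det u = 1 -> \tr u ^+ 2 = 4%:R ->
  exists2 v : 'rV_2, v != 0 & stablemx v u.
Proof.
move=> n2 du tu.
have sing : \det (u - (\tr u / 2%:R)%:M) = 0.
  apply: (lin2 (k := 1) (k' := - 4%:R^-1) du tu); rewrite !mx2E /= !mulr1n !mulr0n.
  have n4 : 4%:R != 0 :> F by rewrite (natrM _ 2 2) mulf_neq0.
  by field; rewrite n4 n2.
have /negP : ~~ row_free (u - (\tr u / 2%:R)%:M).
  by rewrite row_free_unit unitmxE sing unitr0.
rewrite -kermx_eq0 => /negP /rowV0Pn[v /sub_kermxP vk nzv].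
exists v => //; apply/sub_rVP; exists (\tr u / 2%:R).
by apply/eqP; rewrite -subr_eq0 -mul_mx_scalar -mulmxBr vk.
Qed.

(** If the entry [c] of [A] in the bottom left corner is not 0, then [A] is the
    product of an upper, a lower and an upper transvection; otherwise
    multiplication by a lower transvection makes it nonzero. *)
Lemma SL2_transvection_ind (F : fieldType) (Q : 'M[F]_2 -> Prop) :
    (forall A B, Q A -> Q B -> Q (A *m B)) ->
    (forall x, Q (mx2 1 x 0 1)) -> (forall x, Q (mx2 1 0 x 1)) ->
  forall A, \det A = 1 -> Q A.
Proof.
move=> QM QU QL.
have Qc A : \det A = 1 -> A 1 0 != 0 -> Q A.
  move=> dA nz; suff -> : A = mx2 1 ((A 0 0 - 1) / A 1 0) 0 1
      *m mx2 1 0 (A 1 0) 1 *m mx2 1 ((A 1 1 - 1) / A 1 0) 0 1.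
    by apply: (QM _ _ (QM _ _ (QU _) (QL _)) (QU _)).
  move: dA; rewrite det2E => dA.
  apply: eq_mx2; rewrite !(mulmx2E, mxE) /=; [by field | | by field | by field].
  apply: (mulfI nz); apply: (lin1 (k := -1) dA).
  by field.
move=> A dA; have [nz|] := boolP (A 1 0 != 0); first exact: Qc.
rewrite negbK => /eqP c0.
have a0 : A 0 0 != 0.
  apply: contra_eq_neq dA => a0; rewrite det2E c0 a0 mul0r mulr0 subr0 eq_sym.
  exact: oner_neq0.
have -> : A = mx2 1 0 (-1) 1 *m (mx2 1 0 1 1 *m A).
  by apply: eq_mx2; rewrite !(mulmx2E, mxE) /=; ring.
apply: QM; first exact: QL.
apply: Qc; first by rewrite det_mulmx dA mulr1 det2E !mxE /=; ring.
by rewrite mulmx2E c0 !mxE /= mul1r mulr0 addr0.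
Qed.

Lemma mx2_lowerX (R : comNzRingType) (x : R) n :
  mx2 1 0 x 1 ^+ n = mx2 1 0 (x *+ n) 1.
Proof.
elim: n => [|n IHn].
  by rewrite expr0 mulr0n; apply: eq_mx2; rewrite !mxE.
by rewrite exprS IHn; apply: eq_mx2; rewrite !(mulmx2E, mxE) /= ?mulrS; ring.
Qed.

Lemma mx2_upperX (R : comNzRingType) (x : R) n :
  mx2 1 x 0 1 ^+ n = mx2 1 (x *+ n) 0 1.
Proof.
elim: n => [|n IHn].
  by rewrite expr0 mulr0n; apply: eq_mx2; rewrite !mxE.
by rewrite exprS IHn; apply: eq_mx2; rewrite !(mulmx2E, mxE) /= ?mulrS; ring.
Qed.

(** Several convertible group structures can be inferred on [{'GL_2[F]}]; this
    name makes all products use the same one. *)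
Definition GL2 (F : finFieldType) : finGroupType := {'GL_2[F]}.

Lemma GL2_inj (F : finFieldType) (u w : GL2 F) : GLval u = GLval w -> u = w.
Proof. exact: val_inj. Qed.

Lemma GL2_1 (F : finFieldType) : GLval (1%g : GL2 F) = 1%:M.
Proof. exact: GL_1E. Qed.

Lemma GL2_M (F : finFieldType) (u w : GL2 F) :
  GLval (u * w)%g = GLval u *m GLval w.
Proof. exact: GL_MxE. Qed.

Lemma GL2_J (F : finFieldType) (u w : GL2 F) :
  GLval (u ^ w)%g = invmx (GLval w) *m GLval u *m GLval w.
Proof. by rewrite !GL2_M mulmxA; congr (_ *m _ *m _); apply: GL_VxE. Qed.

Lemma GL2_unitmx (F : finFieldType) (u : GL2 F) : GLval u \in unitmx.
Proof. exact: GL_unitmx. Qed.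

Lemma GL2_X (F : finFieldType) (u : GL2 F) n : GLval (u ^+ n)%g = GLval u ^+ n.
Proof. by elim: n => [|n IHn]; rewrite ?GL2_1 // expgS GL2_M IHn exprS. Qed.

Lemma SL2P (F : finFieldType) (u : GL2 F) :
  (u \in SL2 F) = (\det (GLval u) == 1).
Proof. by rewrite inE. Qed.

Lemma prime_field_multiple (p : nat) (x y : 'F_p) :
  prime p -> x != 0 -> exists n, y = x *+ n.
Proof.
move=> pp nzx; exists (y / x)%R.
by rewrite -mulr_natl (natr_Zp (y / x)) divfK.
Qed.

(** Squaring disposes of the sign: [u] may be minus a transvection, its square is
    a transvection with the same axis. *)
Lemma sqr_parabolic (F : fieldType) (u : 'M[F]_2) :
    2%:R != 0 :> F -> \det u = 1 -> \tr u ^+ 2 = 4%:R -> ~~ is_scalar_mx u ->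
  [/\ \det (u *m u) = 1, \tr (u *m u) = 2%:R, ~~ is_scalar_mx (u *m u)
    & forall v : 'rV_2, v != 0 -> stablemx v u -> v *m (u *m u) = v].
Proof.
move=> n2 du tu nsu; have squ := sqr_mx2 u; rewrite du in squ; split.
- by rewrite det_mulmx du mulr1.
- by rewrite squ; apply: (lin1 (k := 1) tu); rewrite !mx2E /= !mulr1n; ring.
- have t0 : \tr u != 0.
    apply: contra_eq_neq tu => ->; rewrite expr0n /= eq_sym.
    by rewrite (natrM _ 2 2) mulf_neq0.
  apply: contra nsu; rewrite squ !scalar_mx2E !mxE /= !mulr1n !mulr0n !subr0.
  rewrite !mulf_eq0 (negPf t0) /= => /and3P[-> ->]; rewrite -subr_eq0 => e.
  rewrite -subr_eq0 -(mulrI_eq0 _ (mulfI t0)); apply/eqP; rewrite -(eqP e).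
  by rewrite !mx2E; ring.
move=> v nzv /sub_rVP[a va].
have vuu : v *m (u *m u) = a ^+ 2 *: v by rewrite mulmxA va -scalemxAl va scalerA.
have : v *m (u *m u) = (\tr u * a - 1) *: v.
  by rewrite squ mulmxBr -scalemxAr va scalerA mul_mx_scalar scale1r scalerBl scale1r.
rewrite vuu => /eqP; rewrite -subr_eq0 -scalerBl scaler_eq0 (negPf nzv) orbF.
rewrite subr_eq0 => /eqP ea.
have e2 : 2%:R * a = \tr u.
  apply/eqP; rewrite -subr_eq0 -sqrf_eq0; apply/eqP.
  by apply: (lin2 (k := 4%:R) (k' := 1) ea tu); ring.
have -> : a ^+ 2 = 1.
  have n4 : 4%:R != 0 :> F by rewrite (natrM _ 2 2) mulf_neq0.
  by apply: (mulfI n4); apply: (lin1 (k := 1) tu); rewrite -e2; ring.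
by rewrite scale1r.
Qed.

(** In the basis [(v, v h)] the square of [u] and its conjugate by [h] are a lower
    and an upper transvection. Over a prime field the powers of a nontrivial
    transvection are all the transvections with the same axis. *)
Lemma parabolic_generation (p : nat) (H : {group GL2 'F_p})
    (u h : GL2 'F_p) (v : 'rV['F_p]_2) :
    prime p -> (2 < p)%N -> u \in H -> h \in H ->
    \det (GLval u) = 1 -> \tr (GLval u) ^+ 2 = 4%:R -> ~~ is_scalar_mx (GLval u) ->
    v != 0 -> stablemx v (GLval u) -> ~~ stablemx v (GLval h) ->
  SL2 'F_p \subset H.
Proof.
move=> pp p2 Hu Hh du tu nsu nzv vu vh.
have n2 : 2%:R != 0 :> 'F_p.
  by rewrite -(dvdn_pcharf (pchar_Fp pp)) gtnNdvd.
have [dU tU nsU vU] := sqr_parabolic n2 du tu nsu.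
have {}vU := vU v nzv vu.
set w := v *m GLval h in vh.
pose P := mx2 (v 0 0) (v 0 1) (w 0 0) (w 0 1).
have uP : P \in unitmx by apply: det_col_rV2.
have r0 : row 0 P = v by apply: eq_rV2; rewrite !mxE.
have r1 : row 1 P = w by apply: eq_rV2; rewrite !mxE.
pose Q A := exists2 g : GL2 'F_p, g \in H & P *m GLval g = A *m P.
have QM A B : Q A -> Q B -> Q (A *m B).
  move=> [g Hg eg] [g' Hg' eg']; exists (g * g')%g; first exact: groupM.
  by rewrite GL2_M mulmxA eg -(mulmxA A P) eg' mulmxA.
have QX A n : Q A -> Q (A ^+ n).
  move=> QA; elim: n => [|n IHn]; last by rewrite exprS; apply: QM.
  by exists 1%g; rewrite // GL2_1 mulmx1 mul1mx.
pose conj (g : 'M_2) := P *m g *m invmx P.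
have det_conj g : \det g = 1 -> \det (conj g) = 1.
  by move=> dg; rewrite -dg /conj !det_mulmx det_inv mulrC mulKr.
have tr_conj g : \tr (conj g) = \tr g.
  by rewrite /conj mxtrace_mulC mulmxA mulVmx ?mul1mx.
have scal_conj g a : conj g = a%:M -> g = a%:M.
  move=> e; have : P *m g = a%:M *m P by rewrite -e /conj mulmxKV.
  rewrite mul_scalar_mx -mul_mx_scalar => /(congr1 (mulmx (invmx P))).
  by rewrite !mulKmx.
have Qconj g : g \in H -> Q (conj (GLval g)) by exists g; rewrite // /conj mulmxKV.
have fix_row g i : row i P *m g = row i P -> forall j, conj g i j = (i == j)%:R.
  move=> e j; have : row i (conj g) = row i 1%:M.
    by rewrite /conj row_mul row_mul e -row_mul mulmxV.
  by move/rowP/(_ j); rewrite !mxE.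
have QL x : Q (mx2 1 0 x 1).
  have HU := groupM Hu Hu.
  have := Qconj _ HU; rewrite GL2_M; set M := conj _ => QM1.
  have e0 : forall j, M 0 j = (0 == j)%:R by apply: fix_row; rewrite r0.
  have e00 := e0 0; have e01 := e0 1; rewrite /= in e00 e01.
  have e11 : M 1 1 = 1.
    have := tr_conj (GLval u *m GLval u); rewrite -/M tU mxtrace2E e00 => e.
    by apply: (addrI 1); rewrite e.
  have nz : M 1 0 != 0.
    apply: contraNneq nsU => e10; apply/is_scalar_mxP; exists 1.
    by apply: scal_conj; apply: eq_mx2; rewrite ?e00 ?e01 ?e10 ?e11 !mxE.
  have [n ->] := prime_field_multiple x pp nz.
  rewrite -mx2_lowerX; apply: QX; suff <- : M = mx2 1 0 (M 1 0) 1 by [].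
  by rewrite [LHS]mx2_eta e00 e01 e11.
have QU x : Q (mx2 1 x 0 1).
  have HU := groupJ (groupM Hu Hu) Hh.
  have := Qconj _ HU; rewrite GL2_J GL2_M; set U := _ *m _ *m GLval h => QM1.
  have uh := GL2_unitmx h; pose M := conj U.
  have e0 : forall j, M 1 j = (1 == j)%:R.
    by apply: fix_row; rewrite r1 /U !mulmxA mulmxK // -(mulmxA v) vU.
  have e00 := e0 0; have e01 := e0 1; rewrite /= in e00 e01.
  have e11 : M 0 0 = 1.
    have : \tr M = 2%:R.
      by rewrite /M tr_conj /U mxtrace_mulC !mulmxA mulmxV // mul1mx.
    by rewrite mxtrace2E e01 => e; apply: (addIr 1); rewrite e.
  have nz : M 0 1 != 0.
    apply: contraNneq nsU => e10; apply/is_scalar_mxP; exists 1.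
    have : U = 1%:M.
      by apply: scal_conj; apply: eq_mx2; rewrite ?e00 ?e01 ?e10 ?e11 !mxE.
    rewrite /U => /(congr1 (fun A => GLval h *m A *m invmx (GLval h))).
    by rewrite !mulmxA mulmxK // mulmx1 mulmxV // mul1mx.
  have [n ->] := prime_field_multiple x pp nz.
  rewrite -mx2_upperX; apply: QX; suff <- : M = mx2 1 (M 0 1) 0 1 by [].
  by rewrite [LHS]mx2_eta e00 e01 e11.
apply/subsetP=> s; rewrite SL2P => /eqP ds.
have [g Hg eg] := SL2_transvection_ind QM QU QL (det_conj _ ds).
suff -> : s = g by [].
apply: GL2_inj; move/(congr1 (mulmx (invmx P))): eg.
by rewrite /conj mulmxKV // !mulKmx.
Qed.

(** * Centralisers and traces in SL2 *)

Lemma GL_lift (F : finFieldType) (A : 'M[F]_2) :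
  \det A = 1 -> exists2 u : GL2 F, u \in SL2 F & GLval u = A.
Proof.
move=> dA; have uA : A \is a GRing.unit.
  by rewrite -[_ \is a _]/(A \in unitmx) unitmxE dA unitr1.
exists ((Sub A uA : {'GL_2[F]}) : GL2 F); last by rewrite -[GLval _]/(val _) SubK.
by rewrite SL2P -[GLval _]/(val _) SubK dA.
Qed.

Lemma GL_commute (F : finFieldType) (u w : GL2 F) :
  commute u w <-> GLval u *m GLval w = GLval w *m GLval u.
Proof. by split=> [e | e]; [rewrite -!GL2_M e | apply: GL2_inj; rewrite !GL2_M]. Qed.

Lemma scalar_commute (R : comNzRingType) (A B : 'M[R]_2) :
  is_scalar_mx A -> A *m B = B *m A.
Proof. by case/is_scalar_mxP=> a ->; rewrite scalar_mxC. Qed.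

(** Commuting with the two elementary transvections already forces a matrix to be
    scalar. *)
Lemma center_SL2 (F : finFieldType) (u : GL2 F) :
  u \in SL2 F -> (u \in 'Z(SL2 F)) = is_scalar_mx (GLval u).
Proof.
move=> SLu; apply/centerP/idP=> [[_ cu] | su]; last first.
  by split=> // w _; apply/GL_commute/scalar_commute.
have cA A : \det A = 1 -> GLval u *m A = A *m GLval u.
  by move=> dA; have [w SLw <-] := GL_lift dA; apply/GL_commute/cu.
have eU := cA (mx2 1 1 0 1); have eL := cA (mx2 1 0 1 1).
rewrite !det2E !mxE /= !(mulr0, mul0r, mulr1, subr0) in eU eL.
have {}eU (i j : 'I_2) := congr1 (fun A : 'M[F]_2 => A i j) (eU erefl).
have {}eL (i j : 'I_2) := congr1 (fun A : 'M[F]_2 => A i j) (eL erefl).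
have c0 := eU 0 0; have d0 := eU 0 1; have b0 := eL 0 0.
rewrite !(mulmx2E, mxE) /= in c0 d0 b0.
rewrite scalar_mx2E; apply/and3P; split; apply/eqP.
- by apply: (lin1 (k := 1) b0); ring.
- by apply: (lin1 (k := -1) c0); ring.
- by apply: (lin1 (k := 1) d0); ring.
Qed.

(** The factors are the Chebyshev polynomials whose roots are the traces of the
    elements of order 2, 3, 4 and 5 modulo the centre. *)
Definition special_trace (R : nzRingType) (t : R) :=
  t * (t ^+ 2 - 1) * (t ^+ 2 - 2%:R) * (t ^+ 4 - 3%:R * t ^+ 2 + 1) == 0.

Lemma special_trace0 (R : nzRingType) : special_trace (0 : R).
Proof. by rewrite /special_trace !mul0r. Qed.

Lemma scalar_affine (F : fieldType) (A : 'M[F]_2) x y :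
  ~~ is_scalar_mx A -> is_scalar_mx (x *: A + y%:M) -> x = 0.
Proof.
rewrite !scalar_mx2E !mxE /= !mulr1n !mulr0n !addr0 !mulf_eq0 (inj_eq (addIr y)).
move=> nsA; apply: contraTeq => nx; rewrite (negPf nx) /=.
by rewrite (inj_eq (mulfI nx)).
Qed.

(** By Cayley-Hamilton [A ^+ k] is [U A - V], where [U] is a Chebyshev polynomial in
    the trace, and it is scalar only if [U = 0]. *)
Lemma special_trace_torsion (F : fieldType) (A : 'M[F]_2) k :
    \det A = 1 -> ~~ is_scalar_mx A -> (0 < k <= 5)%N -> is_scalar_mx (A ^+ k) ->
  special_trace (\tr A).
Proof.
move=> dA nsA; set t := \tr A.
have step n x y : A ^+ n = x *: A + y%:M ->
    A ^+ n.+1 = (t * x + y) *: A + (- x)%:M.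
  move=> e; rewrite exprS e -[_ * _]/(A *m _) mulmxDr -scalemxAr sqr_mx2 dA.
  rewrite mul_mx_scalar scalerBr scalerA scale_scalar_mx mulr1.
  by rewrite addrAC -scalerDl -/t (mulrC x) raddfN.
have A1 : A ^+ 1 = 1 *: A + 0%:M by rewrite scale1r raddf0 addr0.
have A2 := step _ _ _ A1; have A3 := step _ _ _ A2.
have A4 := step _ _ _ A3; have A5 := step _ _ _ A4.
rewrite /special_trace; case: k => [|[|[|[|[|[|k]]]]]] // _.
- by rewrite expr1 (negPf nsA).
- rewrite A2 => /(scalar_affine nsA) e; apply/eqP.
  apply: (lin1 (k := (t ^+ 2 - 1) * (t ^+ 2 - 2%:R) * (t ^+ 4 - 3%:R * t ^+ 2 + 1)) e).
  by ring.
- rewrite A3 => /(scalar_affine nsA) e; apply/eqP.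
  apply: (lin1 (k := t * (t ^+ 2 - 2%:R) * (t ^+ 4 - 3%:R * t ^+ 2 + 1)) e).
  by ring.
- rewrite A4 => /(scalar_affine nsA) e; apply/eqP.
  apply: (lin1 (k := (t ^+ 2 - 1) * (t ^+ 4 - 3%:R * t ^+ 2 + 1)) e).
  by ring.
- rewrite A5 => /(scalar_affine nsA) e; apply/eqP.
  apply: (lin1 (k := t * (t ^+ 2 - 1) * (t ^+ 2 - 2%:R)) e).
  by ring.
Qed.

(** [w + w^-1] is the scalar [\tr w] here, which turns [w g = g w^-1] into the
    linear equation [w g + g w = \tr w g]. *)
Lemma trace_inverting (F : fieldType) (w g : 'M[F]_2) :
    2%:R != 0 :> F -> \det w = 1 -> \tr w ^+ 2 != 4%:R ->
    w *m g + g *m w = \tr w *: g ->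
  \tr g = 0.
Proof.
move=> n2 dw ntw e; have e1 := congr1 mxtrace e.
have e2 := congr1 (fun x => \tr (w *m x)) e.
have tww : \tr (w *m w *m g) = \tr w * \tr (w *m g) - \tr g.
  by rewrite sqr_mx2 dw mulmxBl mul1mx -scalemxAl raddfB /= mxtraceZ.
have a2 : \tr (w *m (g *m w)) = \tr (w *m w *m g).
  by rewrite [LHS]mxtrace_mulC -(mulmxA g) [LHS]mxtrace_mulC.
rewrite mxtraceD mxtraceZ (mxtrace_mulC g) in e1.
rewrite mulmxDr mxtraceD mulmxA a2 tww -scalemxAr mxtraceZ in e2.
have nz : \tr w ^+ 2 - 4%:R != 0 by rewrite subr_eq0.
apply: (mulfI nz); rewrite mulr0.
by apply: (lin2 (k := - \tr w) (k' := 2%:R) e1 e2); ring.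
Qed.

Lemma SL2_inverse (F : finFieldType) (u : GL2 F) :
  u \in SL2 F -> GLval u^-1%g = (\tr (GLval u))%:M - GLval u.
Proof.
rewrite SL2P => /eqP du; have uu : GLval u \in unitmx by exact: GL2_unitmx.
rewrite [LHS]GL_VxE -[LHS]mulmx1.
have -> : 1%:M = GLval u *m ((\tr (GLval u))%:M - GLval u).
  by rewrite mulmxBr sqr_mx2 du mul_mx_scalar opprB addrC subrK.
by rewrite mulKmx.
Qed.

Lemma norm_cent1_conj (gT : finGroupType) (H : {group gT}) (w g : gT) :
  w \in H -> g \in 'N_H('C_H[w])%g -> [/\ g \in H, (w ^ g)%g \in H & commute w (w ^ g)%g].
Proof.
move=> Hw /setIP[Hg nCg].
have : (w ^ g)%g \in 'C_H[w]%g.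
  by rewrite memJ_norm //; apply/setIP; rewrite cent1id.
by case/setIP=> Hwg /cent1P/commute_sym.
Qed.

(** Inside the commutative algebra [F[w]], which is a product of two fields or
    a quadratic extension, only [w] and its conjugate [w^-1] have the trace and
    determinant of [w]. *)
Lemma norm_cent1_SL2 (F : finFieldType) (H : {group GL2 F}) (w g : GL2 F) :
    2%:R != 0 :> F -> H \subset SL2 F -> w \in H -> ~~ is_scalar_mx (GLval w) ->
    \tr (GLval w) ^+ 2 != 4%:R -> g \in 'N_H('C_H[w])%g ->
  (w ^ g)%g = w \/ (w ^ g)%g = w^-1%g.
Proof.
move=> n2 sH Hw nsw ntw /(norm_cent1_conj Hw)[Hg Hwg /GL_commute cw].
have SLw := subsetP sH w Hw; have SLg := subsetP sH g Hg.
have [x [y e]] := comm_mx2P nsw cw.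
have uh : GLval g \in unitmx by exact: GL2_unitmx.
have tJ : \tr (GLval (w ^ g)%g) = \tr (GLval w).
  by rewrite GL2_J mxtrace_mulC mulmxA mulmxV ?mul1mx.
have := SLw; rewrite SL2P => /eqP dw.
have : (w ^ g)%g \in SL2 F by rewrite (subsetP sH).
rewrite SL2P => /eqP dJ.
set t := \tr (GLval w) in tJ ntw.
have et : 2%:R * x + y * t = t.
  by rewrite -{2}tJ e /t !mx2E /= !mulr1n; ring.
have ed : x ^+ 2 + x * y * t + y ^+ 2 = 1.
  rewrite -dJ e; apply: (lin1 (k := - y ^+ 2) dw).
  by rewrite /t !mx2E /= !mulr1n !mulr0n; ring.
have : (y - 1) * (y + 1) = 0.
  have nz : t ^+ 2 - 4%:R != 0 by rewrite subr_eq0.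
  apply: (mulfI nz); rewrite mulr0.
  by apply: (lin2 (k := 2%:R * x + y * t + t) (k' := - 4%:R) et ed); ring.
move/eqP; rewrite mulf_eq0 => /orP[/eqP ey|/eqP ey].
- left; apply: GL2_inj; rewrite e.
  have -> : y = 1 by apply: subr0_eq.
  have -> : x = 0.
    apply: (mulfI n2); rewrite mulr0.
    by apply: (lin2 (k := 1) (k' := - t) et ey); ring.
  by rewrite raddf0 add0r scale1r.
- right; apply: GL2_inj; rewrite e (SL2_inverse SLw).
  have -> : y = -1 by apply/eqP; rewrite -addr_eq0 ey.
  have -> : x = t.
    apply: (mulfI n2).
    by apply: (lin2 (k := 1) (k' := - t) et ey); ring.
  by rewrite scaleN1r.
Qed.

Lemma abelian_cent1_SL2 (F : finFieldType) (H : {group GL2 F}) (w : GL2 F) :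
  ~~ is_scalar_mx (GLval w) -> abelian 'C_H[w]%g.
Proof.
move=> nsw; apply/centsP=> a /setIP[_ /cent1P/GL_commute ca].
move=> b /setIP[_ /cent1P/GL_commute cb]; apply/GL_commute.
have [x [y ->]] := comm_mx2P nsw (esym ca); have [x' [y' ->]] := comm_mx2P nsw (esym cb).
by apply: eq_mx2; rewrite !mx2E /=; ring.
Qed.

Lemma index_norm_cent1 (gT : finGroupType) (H : {group gT}) (w : gT) :
    w \in H -> {in 'N_H('C_H[w]), forall g, (w ^ g)%g = w \/ (w ^ g)%g = w^-1}%g ->
  (#|'N_H('C_H[w]) : 'C_H[w]|%g <= 2)%N.
Proof.
move=> Hw wN; pose N := 'N_H('C_H[w])%G.
have CN : 'C_N[w]%g = 'C_H[w]%g.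
  apply/eqP; rewrite eqEsubset setSI ?subsetIl //= subsetI subsetIr andbT.
  by rewrite subsetI subsetIl normG.
rewrite -[#|_ : _|]/(#|N : 'C_H[w]|) -CN index_cent1.
apply: (@leq_trans #|[set w; w^-1%g]|); last by rewrite cards2; case: eqP.
apply: subset_leq_card; apply/subsetP=> _ /imsetP[g Ng ->].
by rewrite !inE; case: (wN g Ng) => ->; rewrite eqxx ?orbT.
Qed.

Lemma expg_index_central (gT : finGroupType) (H Z : {group gT}) (w : gT) :
    w \in H -> Z \subset H -> H \subset 'C(Z) -> (w ^+ #|'C_H[w] : Z| \in Z)%g.
Proof.
move=> Hw sZH cHZ; have nZw : w \in 'N(Z)%g.
  by rewrite (subsetP (cent_sub Z)) ?(subsetP cHZ).
have nZC : 'C_H[w] \subset 'N(Z).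
  by rewrite (subset_trans (subsetIl _ _)) ?(subset_trans cHZ) ?cent_sub.
apply: coset_idr; first exact: groupX.
rewrite morphX // -card_quotient // expg_cardG // mem_quotient //.
by apply/setIP; rewrite cent1id.
Qed.

(** * Pairs in a common proper subgroup *)

(** The possible shapes of the subgroup generated by [X] and [Y], in terms of
    eigenlines and traces: contained in a Borel subgroup, abelian, dihedral with
    [X] among the rotations, or with all orders at most 5. *)
Definition linked (F : fieldType) (X Y : 'M[F]_2) : Prop :=
  [\/ exists v : 'rV_2, [/\ v != 0, stablemx v X & stablemx v Y],
      X *m Y = Y *m X,
      \tr Y = 0 /\ \tr (X *m Y) = 0
    | [/\ special_trace (\tr X), special_trace (\tr Y)
        & special_trace (\tr (X *m Y))]].

(** Let [H] be generated by [x], [y] and the centre. If [H] contained an element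
    conjugate to plus or minus a transvection, then [x] or [y] would move its
    eigenline and [H] would be the whole group, unless this line is common to [x]
    and [y]. Otherwise centralisers have index at most 2 in their normalisers, and
    [centralizer_dichotomy] applies. If one of them has index at most 2 in [H], the
    elements outside of it invert it and have trace 0, so [x] is inside. If none
    has, all elements have order at most 5 modulo the centre. *)
Lemma proper_pair_linked (p : nat) (x y : GL2 'F_p) :
    prime p -> (2 < p)%N -> x \in SL2 'F_p -> y \in SL2 'F_p ->
    ~~ (SL2 'F_p \subset <<[set x; y] :|: 'Z(SL2 'F_p)>>) -> \tr (GLval x) != 0 ->
  linked (GLval x) (GLval y).
Proof.
move=> pp p2 SLx SLy; set Z := ('Z(SL2 'F_p))%G.
have n2 : 2%:R != 0 :> 'F_p.
  by rewrite -(dvdn_pcharf (pchar_Fp pp)) gtnNdvd.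
pose H : {group GL2 'F_p} := <<[set x; y] :|: Z>>%G; rewrite -[<<_>>]/(gval H) => pH tx.
have Hx : x \in H by rewrite mem_gen // !inE eqxx.
have Hy : y \in H by rewrite mem_gen // !inE eqxx orbT.
have sZH : Z \subset H by rewrite sub_gen // subsetUr.
have sH : H \subset SL2 'F_p.
  by rewrite gen_subG subUset center_sub andbT; apply/subsetP=> z /set2P[]->.
have cHZ : H \subset 'C(Z).
  by rewrite (subset_trans sH) // centsC subsetIr.
have [exy | nxy] := eqVneq (GLval x *m GLval y) (GLval y *m GLval x).
  by constructor 2.
have [/existsP[v /and3P[nzv vx vy]] | noline] :=
    boolP [exists v : 'rV_2, [&& v != 0, stablemx v (GLval x) & stablemx v (GLval y)]].
  by constructor 1; exists v.
have nsx : ~~ is_scalar_mx (GLval x).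
  by apply: contraNN nxy => /scalar_commute ->.
have nsy : ~~ is_scalar_mx (GLval y).
  by apply: contraNN nxy => /scalar_commute ->.
have nsxy : ~~ is_scalar_mx (GLval (x * y)%g).
  apply: contraNN nxy => /(@scalar_commute _ _ (GLval x)); rewrite GL2_M => e.
  apply/eqP; apply: (can_inj (mulKmx (GL2_unitmx x))).
  by rewrite -e mulmxA.
have HZ w : w \in H :\: Z -> [/\ w \in H, \det (GLval w) = 1 & ~~ is_scalar_mx (GLval w)].
  case/setDP=> Hw; have SLw := subsetP sH w Hw.
  by rewrite center_SL2 // => nsw; split=> //; apply/eqP; rewrite -SL2P.
have ntr w : w \in H :\: Z -> \tr (GLval w) ^+ 2 != 4%:R.
  case/HZ=> Hw dw nsw; apply: contraNneq pH => tw.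
  have [v nzv vw] := parabolic_eigenline n2 dw tw.
  have gen h : h \in H -> ~~ stablemx v (GLval h) -> SL2 'F_p \subset H.
    by move=> Hh; apply: (parabolic_generation pp p2 Hw Hh dw tw nsw nzv vw).
  case vx : (stablemx v (GLval x)); last by apply: (gen x) => //; rewrite vx.
  apply: (gen y) => //; apply: contraNN noline => vy.
  by apply/existsP; exists v; rewrite nzv vx.
have abC : {in H :\: Z, forall w, abelian 'C_H[w]%g}.
  by move=> w /HZ[_ _]; apply: abelian_cent1_SL2.
have conjN w g : w \in H :\: Z -> g \in 'N_H('C_H[w])%g ->
    (w ^ g)%g = w \/ (w ^ g)%g = w^-1%g.
  move=> HZw; have [Hw dw nsw] := HZ _ HZw.
  exact: norm_cent1_SL2 n2 sH Hw nsw (ntr _ HZw).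
have nC : {in H :\: Z, forall w, #|'N_H('C_H[w]) : 'C_H[w]|%g <= 2}%N.
  move=> w HZw; have [Hw _ _] := HZ _ HZw.
  by apply: index_norm_cent1 => // g; apply: conjN.
have dich := centralizer_dichotomy sZH cHZ abC nC.
have HZns w : w \in H -> ~~ is_scalar_mx (GLval w) -> w \in H :\: Z.
  by move=> Hw nsw; apply/setDP; rewrite center_SL2 // (subsetP sH).
have [/existsP[w /andP[HZw i2]] | big] :=
    boolP [exists w, (w \in H :\: Z) && (#|H : 'C_H[w]|%g <= 2)%N].
  have [Hw dw nsw] := HZ _ HZw.
  have out g : g \in H -> g \notin 'C_H[w]%g -> \tr (GLval g) = 0.
    move=> Hg nCg; have sCH : 'C_H[w]%g \subset H by apply: subsetIl.
    have i2' : #|H : 'C_H[w]|%g = 2%N.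
      apply/eqP; rewrite eqn_leq i2 indexg_gt1; apply/subsetPn; by exists g.
    have Ng : g \in 'N_H('C_H[w])%g.
      by apply/setIP; split=> //; apply: (subsetP (normal_norm (index2_normal sCH i2'))).
    case: (conjN w g HZw Ng) => [/conjg_fixP/commgP cwg | e].
      by case/negP: nCg; apply/setIP; split=> //; apply/cent1P; exact: commute_sym.
    apply: (trace_inverting n2 dw (ntr _ HZw)).
    have : GLval (w * g)%g = GLval (g * w^-1)%g by rewrite -e conjgE !mulgA mulgV mul1g.
    rewrite !GL2_M (SL2_inverse (subsetP sH w Hw)) => ->.
    by rewrite mulmxBr mul_mx_scalar subrK.
  have Cx : x \in 'C_H[w]%g by apply: contraLR tx => nCx; rewrite negbK out.
  have nCy : y \notin 'C_H[w]%g.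
    apply: contra nxy => Cy; apply/eqP/GL_commute.
    exact: (centsP (abC _ HZw) _ Cx _ Cy).
  constructor 3; split; first exact: out.
  by rewrite -GL2_M out ?groupMl // groupM.
have sp w : w \in H -> ~~ is_scalar_mx (GLval w) -> special_trace (\tr (GLval w)).
  move=> Hw nsw; have HZw := HZns _ Hw nsw; have [_ dw _] := HZ _ HZw.
  have c5 : (#|'C_H[w] : Z|%g <= 5)%N.
    case: (dich _ HZw) => // i2.
    by case/negP: big; apply/existsP; exists w; rewrite HZw.
  apply: (special_trace_torsion dw nsw (k := #|'C_H[w] : Z|%g)).
    by rewrite c5 indexg_gt0.
  rewrite -GL2_X -center_SL2 ?expg_index_central //.
  by rewrite groupX // (subsetP sH).
by constructor 4; split; [apply: sp | apply: sp | rewrite -GL2_M; apply: sp; rewrite ?groupM].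
Qed.

(** * Counting on conics *)

Lemma card_roots_Poly (F : finFieldType) (s : seq F) :
  last 0 s != 0 -> (#|[set x | (Poly s).[x] == 0]%R| <= (size s).-1)%N.
Proof.
move=> nz; have [/size0nil s0 | s_gt0] := posnP (size s).
  by move: nz; rewrite s0 eqxx.
have nzs : Poly s != 0.
  apply: contraNneq nz => e0; have := coef_Poly s (size s).-1.
  by rewrite e0 coef0 nth_last => <-.
rewrite cardE -ltnS prednK //; apply: leq_trans (size_Poly s).
apply: max_poly_roots (enum_uniq _) => //.
by apply/allP=> x; rewrite mem_enum inE.
Qed.

Lemma card_special_trace (F : finFieldType) :
  (#|[set t : F | special_trace t]| <= 9)%N.
Proof.
set s : seq F := [:: 0; 2%:R; 0; - 9%:R; 0; 12%:R; 0; - 6%:R; 0; 1].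
apply: leq_trans (card_roots_Poly (s := s) (oner_neq0 _)).
apply: subset_leq_card; apply/subsetP=> t; rewrite !inE => /eqP e.
by rewrite horner_Poly -e /=; apply/eqP; ring.
Qed.

(** The polynomial is [w ^+ 9] times the one defining [special_trace], taken
    at [w + w^-1]. *)
Lemma card_special_eigenvalue (F : finFieldType) :
  (#|[set w : F | (w != 0) && special_trace (w + w^-1)]%R| <= 18)%N.
Proof.
set s : seq F := [:: 1; 0; 3%:R; 0; 6%:R; 0; 9%:R; 0; 11%:R; 0;
                    11%:R; 0; 9%:R; 0; 6%:R; 0; 3%:R; 0; 1].
apply: leq_trans (card_roots_Poly (s := s) (oner_neq0 _)).
apply: subset_leq_card; apply/subsetP=> w; rewrite !inE => /andP[nzw /eqP e].
apply/eqP; rewrite -[RHS](mulr0 (w ^+ 9)) -e horner_Poly /=.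
by field.
Qed.

Lemma card_le_fibers (T U : finType) (E : {set T}) (S : {set U}) (f : T -> U) k :
    {in E, forall x, f x \in S} ->
    {in S, forall y, #|[set x in E | f x == y]| <= k}%N ->
  (#|E| <= #|S| * k)%N.
Proof.
move=> fS fk; rewrite -sum1_card (partition_big f (mem S)) //=.
rewrite -sum_nat_const; apply: leq_sum => y Sy.
apply: leq_trans (fk y Sy); rewrite -sum1_card leq_eqVlt; apply/orP; left.
by apply/eqP/eq_bigl => x; rewrite inE.
Qed.

Lemma card_ge_fibers (T U : finType) (E : {set T}) (S : {set U}) (f : T -> U) k :
    {in E, forall x, f x \in S} ->
    {in S, forall y, k <= #|[set x in E | f x == y]|}%N ->
  (#|S| * k <= #|E|)%N.
Proof.
move=> fS fk; rewrite -[leqRHS]sum1_card (partition_big f (mem S)) //=.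
rewrite -sum_nat_const; apply: leq_sum => y Sy.
apply: leq_trans (fk y Sy) _; rewrite -sum1_card leq_eqVlt; apply/orP; left.
by apply/eqP/eq_bigl => x; rewrite inE.
Qed.

(** Once one point [Y0] is fixed, the others are determined by the direction in
    which they are seen from [Y0]: on a line through [Y0] the equation
    [\det = 1] is quadratic, with nonzero leading coefficient [\det (Y - Y0)]. *)
Lemma card_anisotropic_conic (F : finFieldType) (E : {set 'M[F]_2})
    (a b c a' b' c' : F) :
    {in E, forall Y : 'M_2, [/\ \det Y = 1, Y 0 1 = a + b * Y 0 0 + c * Y 1 0
       & Y 1 1 = a' + b' * Y 0 0 + c' * Y 1 0]} ->
    {in E &, forall Y Y' : 'M_2, Y != Y' -> \det (Y - Y') != 0} ->
  (#|E| <= #|F| + 2)%N.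
Proof.
move=> planeE aniso; have [->|[Y0 E0]] := set_0Vmem E; first by rewrite cards0.
have [d0 e01 e11] := planeE _ E0.
pose f (Y : 'M[F]_2) : option (option F) := if Y == Y0 then None else
  if Y 0 0 == Y0 0 0 then Some None
  else Some (Some ((Y 1 0 - Y0 1 0) / (Y 0 0 - Y0 0 0))).
suff inj : {in E &, injective f}.
  rewrite -(card_in_imset inj); apply: leq_trans (max_card _) _.
  by rewrite !card_option addn2.
have same_line (Y1 Y2 : 'M[F]_2) k : Y1 \in E -> Y2 \in E -> Y1 != Y0 -> Y2 != Y0 ->
   Y1 0 0 - Y0 0 0 = k * (Y2 0 0 - Y0 0 0) -> Y1 1 0 - Y0 1 0 = k * (Y2 1 0 - Y0 1 0) ->
   Y1 = Y2.
  move=> E1 E2 n1 n2 h0 h1.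
  have [d1 p1 q1] := planeE _ E1; have [d2 p2 q2] := planeE _ E2.
  have h01 : Y1 0 1 - Y0 0 1 = k * (Y2 0 1 - Y0 0 1).
    rewrite p1 p2 e01; apply: (lin2 (k := b) (k' := c) h0 h1); ring.
  have h11 : Y1 1 1 - Y0 1 1 = k * (Y2 1 1 - Y0 1 1).
    rewrite q1 q2 e11; apply: (lin2 (k := b') (k' := c') h0 h1); ring.
  have nz := aniso _ _ E2 E0 n2; rewrite det2E !mxE in nz.
  have g0 : Y1 0 0 = Y0 0 0 + k * (Y2 0 0 - Y0 0 0) by rewrite -h0 addrC subrK.
  have g1 : Y1 1 0 = Y0 1 0 + k * (Y2 1 0 - Y0 1 0) by rewrite -h1 addrC subrK.
  have g01 : Y1 0 1 = Y0 0 1 + k * (Y2 0 1 - Y0 0 1) by rewrite -h01 addrC subrK.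
  have g11 : Y1 1 1 = Y0 1 1 + k * (Y2 1 1 - Y0 1 1) by rewrite -h11 addrC subrK.
  have k0 : k != 0.
    apply: contra_neq n1 => k0; apply: eq_mx2; rewrite ?g0 ?g1 ?g01 ?g11 k0; ring.
  have k1 : k - 1 = 0.
    move: d0 d1 d2; rewrite !det2E g0 g1 g01 g11 => d0 d1 d2.
    apply: (mulfI k0); rewrite mulr0; apply: (mulfI nz).
    by apply: (lin3 (k := 1) (k' := - k) (k'' := k - 1) d1 d2 d0); ring.
  have {}k1 : k = 1 by apply: subr0_eq.
  by apply: eq_mx2; rewrite ?g0 ?g1 ?g01 ?g11 k1; ring.
move=> Y1 Y2 E1 E2; rewrite /f.
have [->|n1] := eqVneq Y1 Y0; have [->|n2] := eqVneq Y2 Y0 => //; try by case: ifP.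
have [e1|z1] := eqVneq (Y1 0 0) (Y0 0 0); have [e2|z2] := eqVneq (Y2 0 0) (Y0 0 0) => // e.
  have z : Y2 1 0 - Y0 1 0 != 0.
    rewrite subr_eq0; apply: contra_neq n2 => e3.
    have [_ p2 q2] := planeE _ E2.
    by apply: eq_mx2; rewrite ?p2 ?q2 ?e01 ?e11 ?e2 ?e3.
  apply: (same_line _ _ ((Y1 1 0 - Y0 1 0) / (Y2 1 0 - Y0 1 0))) => //.
    by rewrite e1 e2 !subrr mulr0.
  by rewrite divfK.
rewrite -subr_eq0 in z1; rewrite -subr_eq0 in z2.
apply: (same_line _ _ ((Y1 0 0 - Y0 0 0) / (Y2 0 0 - Y0 0 0))) => //.
  by rewrite divfK.
by case: e => e; rewrite mulrAC -mulrA -e; field.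
Qed.

(** * Linked families: elliptic case *)

Lemma card_special_fibers (F : finFieldType) (E : {set 'M[F]_2}) (Z : 'M[F]_2) k :
    {in E, forall Y, special_trace (\tr Y) /\ special_trace (\tr (Z *m Y))} ->
    (forall s t, #|[set Y in E | (\tr Y == s) && (\tr (Z *m Y) == t)]| <= k)%N ->
  (#|E| <= #|[set t : F | special_trace t]| ^ 2 * k)%N.
Proof.
move=> spE fk; rewrite -mulnn -cardsX.
apply: (card_le_fibers (f := fun Y => (\tr Y, \tr (Z *m Y)))).
  by move=> Y /spE[sY sZY]; rewrite !inE /= sY sZY.
move=> [s t] _; apply: leq_trans (fk s t); apply: subset_leq_card.
by apply/subsetP=> Y; rewrite !inE xpair_eqE.
Qed.

Lemma linked_cases (F : fieldType) (X Y : 'M[F]_2) : linked X Y ->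
  [\/ exists v : 'rV_2, [/\ v != 0, stablemx v X & stablemx v Y], X *m Y = Y *m X
    | special_trace (\tr Y) /\ special_trace (\tr (X *m Y))].
Proof.
case=> [lv | cXY | [-> ->] | [_ sY sXY]].
- by constructor 1.
- by constructor 2.
- by constructor 3; split; apply: special_trace0.
- by constructor 3.
Qed.

(** Both the centraliser of [Z] and the set of all [Y] with given [\tr Y] and
    [\tr (Z Y)] are conics in an affine plane; a singular difference of two
    distinct points would produce an eigenline of [Z]. *)
Lemma card_elliptic_linked (F : finFieldType) (E : {set 'M[F]_2}) (Z : 'M[F]_2) :
    (forall v : 'rV_2, v != 0 -> ~~ stablemx v Z) ->
    {in E, forall Y, \det Y = 1} -> {in E, forall Y, linked Z Y} ->
  (#|E| <= (#|[set t : F | special_trace t]| ^ 2 + 1) * (#|F| + 2))%N.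
Proof.
move=> ell dE linkE.
have Z10 : Z 1 0 != 0.
  have nzv : delta_mx 0 1 != 0 :> 'rV[F]_2 by rewrite rV2_neq0 !mxE /= oner_neq0 orbT.
  apply: contraNneq (ell _ nzv) => z; apply/(rV2_colinearP _ nzv).
  by rewrite !(mulmx2E, mxE) /= z; ring.
pose E1 := [set Y in E | Z *m Y == Y *m Z].
have card1 : (#|E1| <= #|F| + 2)%N.
  apply: (@card_anisotropic_conic _ E1 0 0 (Z 0 1 / Z 1 0) 0 1 ((Z 1 1 - Z 0 0) / Z 1 0)).
    move=> Y; rewrite inE => /andP[/dE dY /eqP cY].
    have c00 := congr1 (fun A : 'M[F]_2 => A 0 0) cY.
    have c10 := congr1 (fun A : 'M[F]_2 => A 1 0) cY.
    rewrite !mulmx2E in c00 c10.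
    split=> //; apply: (mulfI Z10).
      by apply: (lin1 (k := -1) c00); field.
    by apply: (lin1 (k := -1) c10); field.
  move=> Y Y'; rewrite !inE => /andP[EY /eqP cY] /andP[EY' /eqP cY'] nYY.
  apply: contraTneq isT => sing.
  have cD : Z *m (Y - Y') = (Y - Y') *m Z by rewrite mulmxBr mulmxBl cY cY'.
  have nsZ : ~~ is_scalar_mx Z.
    by rewrite scalar_mx2E (negPf Z10) andbF.
  have [x [y eD]] := comm_mx2P nsZ cD.
  have /negP : ~~ row_free (Y - Y').
    by rewrite row_free_unit unitmxE sing unitr0.
  rewrite -kermx_eq0 => /negP /rowV0Pn[v /sub_kermxP vk nzv].
  have ny : y != 0.
    apply: contra_neq nYY => y0; move: sing eD; rewrite y0 scale0r addr0 => sing eD.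
    move: sing; rewrite eD det_scalar => /eqP; rewrite expf_eq0 /= => /eqP x0.
    by apply: subr0_eq; rewrite eD x0 raddf0.
  case/negP: (ell _ nzv); apply/sub_rVP; exists (- x / y).
  apply: (scalerI ny); rewrite scalerA mulrC divfK //.
  move: vk; rewrite eD mulmxDr mul_mx_scalar -scalemxAr => /eqP.
  by rewrite addrC addr_eq0 scaleNr => /eqP.
have card2 : (#|E :\: E1| <= #|[set t : F | special_trace t]| ^ 2 * (#|F| + 2))%N.
  apply: (@card_special_fibers _ _ Z).
    move=> Y /setDP[EY]; rewrite inE EY /= => ncY.
    case: (linked_cases (linkE _ EY)) => [[v [nzv vZ _]] | cY | //].
      by case/negP: (ell _ nzv).
    by case/eqP: ncY.
  move=> s t; set E2 := finset _.
  apply: (@card_anisotropic_conic _ E2 ((t - Z 1 1 * s) / Z 1 0)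
    ((Z 1 1 - Z 0 0) / Z 1 0) (- Z 0 1 / Z 1 0) s (-1) 0).
    move=> Y; rewrite !inE => /andP[/andP[_ /dE dY] /andP[/eqP tY /eqP tZY]].
    rewrite !mxtrace2E ?mulmx2E in tY tZY.
    split=> //; last by rewrite -tY; ring.
    by apply: (mulfI Z10); rewrite -tY -tZY; field.
  move=> Y Y'; rewrite !inE.
  move=> /andP[_ /andP[/eqP tY /eqP tZY]] /andP[_ /andP[/eqP tY' /eqP tZY']].
  rewrite -subr_eq0; set D := Y - Y' => nzD; apply: contraTneq isT => sing.
  have tD : D 0 0 + D 1 1 = 0.
    by rewrite -mxtrace2E /D raddfB /= tY tY' subrr.
  have : \tr (Z *m D) = 0 by rewrite /D mulmxBr raddfB /= tZY tZY' subrr.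
  rewrite mxtrace2E !mulmx2E => tZD.
  rewrite det2E in sing.
  have {}tD : D 1 1 = - D 0 0 by apply/eqP; rewrite -addr_eq0 addrC tD.
  rewrite tD in sing tZD.
  clearbody D; have [r0 | nz] := eqVneq (row 0 D) 0.
    have d0 : D 0 0 = 0 by move/rowP/(_ 0): r0; rewrite !mxE.
    have d1 : D 0 1 = 0 by move/rowP/(_ 1): r0; rewrite !mxE.
    have nz : row 1 D != 0.
      apply: contraNneq nzD => r1; apply/eqP/row_matrixP=> i.
      by case: (ord2P i) => ->; rewrite ?r0 ?r1 row0.
    case/negP: (ell _ nz); apply/(rV2_colinearP _ nz).
    rewrite !mulmx2E !mxE tD; apply: (lin3 (k := D 1 0) (k' := 0) (k'' := 0) tZD d0 d1).
    by rewrite d0 d1; ring.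
  case/negP: (ell _ nz); apply/(rV2_colinearP _ nz).
  rewrite !mulmx2E !mxE.
  by apply: (lin2 (k := - D 0 1) (k' := - Z 0 1) tZD sing); ring.
rewrite -(cardsID E1 E) (setIidPr _); last by apply/subsetP=> Y; rewrite inE => /andP[].
by rewrite mulnDl mul1n addnC leq_add.
Qed.

(** * Linked families: hyperbolic case *)

Definition linked_family (F : finFieldType) (E : {set 'M[F]_2}) : Prop :=
  [/\ {in E, forall X, \det X = 1},
      {in E, forall X, ~~ is_scalar_mx X -> \tr X ^+ 2 != 4%:R}
    & {in E &, forall X Y, \tr X != 0 -> linked X Y}].

Lemma is_scalar_conj (F : fieldType) (P X : 'M[F]_2) : P \in unitmx ->
  is_scalar_mx (P *m X *m invmx P) = is_scalar_mx X.
Proof.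
move=> uP; apply/is_scalar_mxP/is_scalar_mxP=> -[a e]; exists a.
  apply: (can_inj (mulKmx uP)).
  by rewrite /= scalar_mxC -e mulmxKV.
by rewrite e scalar_mxC mulmxK.
Qed.

Lemma linked_conj (F : fieldType) (P X Y : 'M[F]_2) : P \in unitmx ->
  linked X Y -> linked (P *m X *m invmx P) (P *m Y *m invmx P).
Proof.
move=> uP; have M : P *m X *m invmx P *m (P *m Y *m invmx P) = P *m (X *m Y) *m invmx P.
  by rewrite !mulmxA mulmxKV.
have tr A : \tr (P *m A *m invmx P) = \tr A.
  by rewrite mxtrace_mulC mulKmx.
case=> [[v [nzv vX vY]] | c | [tY tXY] | [sX sY sXY]].
- constructor 1; exists (v *m invmx P).
  have st A : stablemx v A -> stablemx (v *m invmx P) (P *m A *m invmx P).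
    by move=> vA; rewrite !mulmxA mulmxKV // submxMr.
  split; [ | exact: st | exact: st].
  by apply: contraNneq nzv => e; rewrite -(mulmxKV uP v) e mul0mx.
- by constructor 2; rewrite M c !mulmxA mulmxKV.
- by constructor 3; rewrite M !tr.
- by constructor 4; rewrite M !tr.
Qed.

Lemma linked_family_conj (F : finFieldType) (P : 'M[F]_2) (E : {set 'M[F]_2}) :
  P \in unitmx -> linked_family E ->
  linked_family [set P *m X *m invmx P | X in E].
Proof.
move=> uP [dE pE lE].
have tr A : \tr (P *m A *m invmx P) = \tr A by rewrite mxtrace_mulC mulKmx.
split=> [_ /imsetP[X EX ->] | _ /imsetP[X EX ->] | _ _ /imsetP[X EX ->] /imsetP[Y EY ->]].
- have dP : \det P != 0 by rewrite -unitfE -unitmxE.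
  by rewrite !det_mulmx det_inv (dE X EX) mulr1 divff.
- by rewrite is_scalar_conj // tr; apply: pE.
- by rewrite tr => tX; apply: linked_conj => //; apply: lE.
Qed.

(** The lower triangular [W] of the family is determined by its diagonal entry [w]
    and its entry [e] below the diagonal. Either [w + w^-1] is special, which
    leaves at most 18 values of [w]; or the second eigenvector [(r, 1)] of [W] is an
    eigenvector of [Y] or is the image of [(1, 0)] under [Y], which leaves at most
    3 values of [r], and [r] and [w] determine [e]. *)
Lemma card_lower_linked (F : finFieldType) (E : {set 'M[F]_2}) (Y : 'M[F]_2) :
    linked_family E -> Y \in E -> Y 0 1 != 0 ->
  (#|[set W in E | (W 0 1 == 0) && (W 1 0 != 0)]%R| <= 21 * #|F|.-1)%N.
Proof.
move=> [dE pE lE] EY Y01; set L := finset _.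
have LP W : W \in L -> [/\ W \in E, W 0 1 = 0, W 1 0 != 0, W 0 0 != 0
    & W 1 1 = (W 0 0)^-1].
  rewrite inE => /and3P[EW /eqP W01 W10]; have := dE _ EW.
  rewrite det2E W01 mul0r subr0 => dW.
  have W00 : W 0 0 != 0.
    by apply: contra_eq_neq dW => ->; rewrite mul0r eq_sym oner_neq0.
  by split=> //; apply: (mulfI W00); rewrite dW divff.
(* The slopes [r] of the eigenlines of [Y], and the slope of the image of
   [(1, 0)] under [Y]. *)
pose R := Y 0 0 / Y 0 1 |:
  [set r | (Poly [:: - Y 1 0; Y 1 1 - Y 0 0; Y 0 1]).[r] == 0].
pose S := [set w : F | (w != 0) && special_trace (w + w^-1)].
have cS : (#|S| <= 18)%N by exact: card_special_eigenvalue.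
pose L1 := [set W in L | W 0 0 \in S].
pose g (x : F * F) := mx2 x.2 0 (x.1 * (x.2^-1 - x.2)) x.2^-1.
have sub : L \subset L1 :|: g @: setX R [set~ 0].
  apply/subsetP=> W LW; case: (LP W LW) => EW W01 W10 W00 W11; apply/setUP.
  have [SW|nS] := boolP (W 0 0 \in S); [by left; rewrite inE LW | right].
  have nsp : ~~ special_trace (\tr W).
    by move: nS; rewrite inE W00 /= mxtrace2E W11.
  have finish r : r \in R -> W 1 0 = r * (W 1 1 - W 0 0) -> W \in g @: setX R [set~ 0].
    move=> Rr e; apply/imsetP; exists (r, W 0 0); first by apply/setXP; rewrite !inE in Rr *.
    by rewrite [LHS]mx2_eta /g /= W01 e W11.
  have tW : \tr W != 0 by apply: contraNneq nsp => ->; apply: special_trace0.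
  case: (lE W Y EW EY tW) =>
    [[v [nzv vW vY]] | c | [tY tWY] | [/idP sW _ _]]; last by rewrite sW in nsp.
  - move: vW vY; rewrite !rV2_colinearP // !mulmx2E W01 => vW vY.
    have v1 : v 0 1 != 0.
      apply: contraTneq nzv => v1; rewrite rV2_neq0 v1 eqxx orbF negbK -sqrf_eq0.
      rewrite -(mulIr_eq0 _ (mulIf Y01)); apply/eqP; move: vY; rewrite v1 => vY.
      by apply: (lin1 (k := 1) vY); ring.
    apply: (finish (v 0 0 / v 0 1)); rewrite ?inE.
      apply/orP; right; rewrite horner_Poly /=; apply/eqP.
      apply: (mulfI (mulf_neq0 v1 v1)); apply: (lin1 (k := 1) vY).
      by field.
    apply: (mulfI (mulf_neq0 v1 v1)); apply: (lin1 (k := -1) vW).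
    by field.
  - have := congr1 (fun A : 'M[F]_2 => A 0 0) c; rewrite /= !mulmx2E W01 => e.
    have /eqP : Y 0 1 * W 1 0 = 0 by apply: (lin1 (k := -1) e); ring.
    by rewrite mulf_eq0 (negPf Y01) (negPf W10).
  - apply: (finish (Y 0 0 / Y 0 1)); first by rewrite !inE eqxx.
    rewrite mxtrace2E in tY; move: tWY; rewrite mxtrace2E !mulmx2E W01 => tWY.
    by apply: (mulfI Y01); apply: (lin2 (k := 1) (k' := - W 1 1) tWY tY); field.
have card1 : (#|L1| <= 18 * #|F|.-1)%N.
  have inj : {in L1 &, injective (fun W : 'M[F]_2 => (W 0 0, W 1 0))}.
    move=> W W' /setIdP[/LP[_ a _ _ b] _] /setIdP[/LP[_ a' _ _ b'] _].
    by case=> e0 e1; apply: eq_mx2; rewrite ?a ?a' ?b ?b' ?e0.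
  rewrite -(card_in_imset inj) -(cardsC1 (0 : F)).
  apply: (@leq_trans #|setX S [set~ 0]|); last first.
    by rewrite cardsX; apply: leq_mul (leqnn _).
  apply: subset_leq_card; apply/subsetP=> _ /imsetP[W LW ->].
  by case/setIdP: LW => /LP[_ _ W10 _ _] SW; apply/setXP; rewrite !inE in SW *.
have card2 : (#|g @: setX R [set~ 0%R]| <= 3 * #|F|.-1)%N.
  apply: leq_trans (leq_imset_card _ _) _; rewrite cardsX cardsC1.
  apply: leq_mul (leqnn _); rewrite cardsU1; apply: (@leq_add _ _ 1%N 2%N) (leq_b1 _) _.
  exact: (card_roots_Poly (s := [:: _; _; _])).
apply: leq_trans (subset_leq_card sub) _; apply: leq_trans (leq_card_setU _ _) _.
by rewrite (mulnDl 18 3) leq_add.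
Qed.

(** The family is cut into its diagonal elements, the other triangular ones, and
    those with no zero off the diagonal. For the last ones [\tr Y] and [\tr (Z Y)]
    are special and determine the diagonal of [Y], so that one entry off the
    diagonal determines the other. The triangular ones are bounded with the help
    of [Y1] and [Y2], since a whole Borel subgroup would be too large. *)
Lemma card_hyperbolic_linked (F : finFieldType) (E : {set 'M[F]_2}) (Z Y1 Y2 : 'M[F]_2) :
    linked_family E -> Z \in E -> Z 0 1 = 0 -> Z 1 0 = 0 -> Z 0 0 != Z 1 1 ->
    \tr Z != 0 -> Y1 \in E -> Y1 0 1 != 0 -> Y2 \in E -> Y2 1 0 != 0 ->
  (#|E| <= (#|[set t : F | special_trace t]| ^ 2 + 43) * #|F|.-1)%N.
Proof.
move=> fE EZ Z01 Z10 nZ tZ EY1 nY1 EY2 nY2; have [dE pE lE] := fE.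
set L := [set W in E | (W 0 1 == 0) && (W 1 0 != 0)].
set U := [set W in E | (W 1 0 == 0) && (W 0 1 != 0)].
set D := [set W in E | (W 1 0 == 0) && (W 0 1 == 0)].
set R := [set W in E | (W 1 0 != 0) && (W 0 1 != 0)].
have cL : (#|L| <= 21 * #|F|.-1)%N by apply: card_lower_linked EY1 nY1.
have cU : (#|U| <= 21 * #|F|.-1)%N.
  (* Exchanging the two basis vectors turns upper triangular matrices into lower
     triangular ones. *)
  pose P : 'M[F]_2 := mx2 0 1 1 0.
  have uP : P \in unitmx by rewrite unitmxE det2E !mxE /= mul0r mulr1 sub0r unitrN1.
  have iP : invmx P = P.
    apply: (can_inj (mulKmx uP)); rewrite mulmxV //.
    by apply: eq_mx2; rewrite !(mulmx2E, mxE) /=; ring.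
  pose c X := P *m X *m invmx P.
  have cE X : c X = mx2 (X 1 1) (X 1 0) (X 0 1) (X 0 0).
    by rewrite /c iP; apply: eq_mx2; rewrite !mulmx2E !mxE /=; ring.
  have injc : injective c.
    move=> X X'; rewrite !cE => e.
    by apply: eq_mx2; [have := congr1 (fun A : 'M[F]_2 => A 1 1) e
      | have := congr1 (fun A : 'M[F]_2 => A 1 0) e
      | have := congr1 (fun A : 'M[F]_2 => A 0 1) e
      | have := congr1 (fun A : 'M[F]_2 => A 0 0) e]; rewrite /= !mxE.
  rewrite -(card_imset _ injc).
  apply: leq_trans (card_lower_linked (linked_family_conj uP fE) (imset_f c EY2) _); last first.
    by rewrite cE mxE.
  apply: subset_leq_card; apply/subsetP=> _ /imsetP[W UW ->].
  move: UW; rewrite inE => /andP[EW nW].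
  by rewrite inE imset_f //= cE !mxE.
have cD : (#|D| <= #|F|.-1)%N.
  have DP W : W \in D -> [/\ W 0 1 = 0, W 1 0 = 0 & W 0 0 * W 1 1 = 1].
    rewrite inE => /and3P[EW /eqP W10 /eqP W01]; split=> //.
    by have := dE _ EW; rewrite det2E W01 mul0r subr0.
  have inj : {in D &, injective (fun W : 'M[F]_2 => W 0 0)}.
    move=> W W' /DP[a b c] /DP[a' b' c'] /= e.
    have nz : W 0 0 != 0 by apply: contra_eq_neq c => ->; rewrite mul0r eq_sym oner_neq0.
    apply: eq_mx2; rewrite ?a ?a' ?b ?b' //.
    by apply: (mulfI nz); rewrite c e c'.
  rewrite -(card_in_imset inj) -(cardsC1 (0 : F)).
  apply: subset_leq_card; apply/subsetP=> _ /imsetP[W /DP[_ _ c] ->].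
  by rewrite !inE; apply: contra_eq_neq c => ->; rewrite mul0r eq_sym oner_neq0.
have cR : (#|R| <= #|[set t : F | special_trace t]| ^ 2 * #|F|.-1)%N.
  apply: (@card_special_fibers _ _ Z) => [Y | s t].
    rewrite inE => /and3P[EY Y10 Y01].
    case: (linked_cases (lE _ _ EZ EY tZ)) => [[v [nzv vZ vY]] | c | //].
      move: vZ vY; rewrite !rV2_colinearP // !mulmx2E Z01 Z10 => vZ vY.
      have /eqP : (Z 0 0 - Z 1 1) * (v 0 0 * v 0 1) = 0 by apply: (lin1 (k := -1) vZ); ring.
      rewrite mulf_eq0 subr_eq0 (negPf nZ) mulf_eq0 /= => /orP[/eqP v0|/eqP v1].
        move: nzv; rewrite rV2_neq0 v0 eqxx /= => v1.
        have /eqP : v 0 1 * v 0 1 * Y 1 0 = 0 by apply: (lin1 (k := -1) vY); rewrite v0; ring.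
        by rewrite !mulf_eq0 (negPf v1) (negPf Y10).
      move: nzv; rewrite rV2_neq0 v1 eqxx orbF => v0.
      have /eqP : v 0 0 * v 0 0 * Y 0 1 = 0 by apply: (lin1 (k := 1) vY); rewrite v1; ring.
      by rewrite !mulf_eq0 (negPf v0) (negPf Y01).
    have := congr1 (fun A : 'M[F]_2 => A 0 1) c; rewrite /= !mulmx2E Z01 => e.
    have /eqP : (Z 0 0 - Z 1 1) * Y 0 1 = 0 by apply: (lin1 (k := 1) e); ring.
    by rewrite mulf_eq0 subr_eq0 (negPf nZ) (negPf Y01).
  set E2 := finset _.
  have inj : {in E2 &, injective (fun Y : 'M[F]_2 => Y 0 1)}.
    move=> Y Y'; rewrite !inE => /andP[/and3P[EY _ Y01] /andP[/eqP tY /eqP tZY]].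
    move=> /andP[/and3P[EY' _ Y01'] /andP[/eqP tY' /eqP tZY']] /= e.
    have nZ' : Z 0 0 - Z 1 1 != 0 by rewrite subr_eq0.
    rewrite -tY' !mxtrace2E in tY; rewrite -tZY' !mxtrace2E !mulmx2E Z01 Z10 in tZY.
    have e00 : Y 0 0 = Y' 0 0.
      by apply: (mulfI nZ'); apply: (lin2 (k := 1) (k' := - Z 1 1) tZY tY); ring.
    have e11 : Y 1 1 = Y' 1 1 by apply: (addrI (Y 0 0)); rewrite tY e00.
    apply: eq_mx2 => //; apply: (mulfI Y01).
    have := dE _ EY; rewrite -(dE _ EY') !det2E e00 e11 e => d.
    by apply: (lin1 (k := -1) d); ring.
  rewrite -(card_in_imset inj) -(cardsC1 (0 : F)).
  apply: subset_leq_card; apply/subsetP=> _ /imsetP[Y E2Y ->].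
  by move: E2Y; rewrite !inE => /andP[/and3P[_ _ ->]].
have sub : E \subset (L :|: U) :|: (D :|: R).
  apply/subsetP=> W EW; rewrite !inE EW /=.
  by case: (W 0 1 == 0); case: (W 1 0 == 0).
apply: leq_trans (subset_leq_card sub) _; apply: leq_trans (leq_card_setU _ _) _.
have cLU := leq_trans (leq_card_setU L U) (leq_add cL cU).
have cDR := leq_trans (leq_card_setU D R) (leq_add cD cR).
apply: leq_trans (leq_add cLU cDR) _; move: #|F|.-1 (_ ^ 2)%N; clear => n m.
by rewrite mulnDl; lia.
Qed.

(** * Elements of order two modulo the centre *)

(** At least half of the elements are squares, hence more than half as the order
    is odd, so the set of squares meets its image under [x -> b - x]. *)
Lemma sum_two_squares (F : finFieldType) (b : F) : odd #|F| ->
  exists x y, x ^+ 2 + y ^+ 2 = b.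
Proof.
move=> oddF; pose S := [set x ^+ 2 | x : F]; pose S' := [set b - y | y in S].
have cS : (#|F| <= #|S| * 2)%N.
  rewrite -cardsT; apply: (card_le_fibers (f := fun x => x ^+ 2)).
    by move=> x _; apply: imset_f.
  move=> _ /imsetP[x _ ->]; apply: (@leq_trans #|[set x; - x]|).
    apply: subset_leq_card; apply/subsetP=> y; rewrite !inE /= eqf_sqr.
    by [].
  by rewrite cards2; case: eqP.
have cS' : #|S'| = #|S| by apply: card_imset => x y /addrI/oppr_inj.
have [/existsP[z /andP[/imsetP[x _ ->] /imsetP[_ /imsetP[y _ ->] e]]] | no] :=
    boolP [exists z, (z \in S) && (z \in S')].
  by exists x, y; rewrite e subrK.
have dis : S :&: S' = set0.
  by apply/setP=> z; rewrite !inE; apply: contraNF no => zS; apply/existsP; exists z.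
have le : (#|S| * 2 <= #|F|)%N.
  apply: leq_trans (max_card (mem (S :|: S'))).
  by rewrite cardsU dis cards0 cS' subn0 muln2 addnn.
have e : #|F| = (#|S| * 2)%N by apply/eqP; rewrite eqn_leq cS.
by rewrite e oddM andbF in oddF.
Qed.

(** A trace-zero [u] satisfies [u ^+ 2 = -1], so it has the matrix
    [[0, 1], [-1, 0]] in every basis [(x, x u)]; the base change has determinant
    1 as soon as a binary quadratic form of discriminant -4 takes the value 1
    at [x]. *)
Lemma trace0_conj (F : finFieldType) (u : GL2 F) :
    odd #|F| -> 2%:R != 0 :> F -> u \in SL2 F -> \tr (GLval u) = 0 ->
  exists2 g : GL2 F, g \in SL2 F & GLval g *m GLval u = mx2 0 1 (-1) 0 *m GLval g.
Proof.
move=> oddF n2 SLu tu; move: SLu; rewrite SL2P => /eqP du.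
set A := GLval u in tu du *.
have A11 : A 1 1 = - A 0 0.
  by apply/eqP; rewrite -addr_eq0 addrC -mxtrace2E tu.
rewrite det2E A11 in du.
have [x [y Q]] : exists x y, A 0 1 * x ^+ 2 - 2%:R * A 0 0 * x * y - A 1 0 * y ^+ 2 = 1.
  have [b0|nb] := eqVneq (A 0 1) 0; last first.
    have [X [Y XY]] := sum_two_squares (A 0 1) oddF.
    exists ((X + A 0 0 * Y) / A 0 1), Y; apply: (mulfI nb).
    by apply: (lin2 (k := 1) (k' := Y ^+ 2) XY du); field.
  have [c0|nc] := eqVneq (A 1 0) 0; last first.
    have [X [Y XY]] := sum_two_squares (- A 1 0) oddF.
    exists Y, ((X - A 0 0 * Y) / A 1 0); apply: (mulfI nc).
    by apply: (lin2 (k := -1) (k' := - Y ^+ 2) XY du); field.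
  rewrite b0 c0 in du *; have na : A 0 0 != 0.
    by apply: contra_eq_neq du => ->; rewrite !mul0r subr0 eq_sym oner_neq0.
  by exists 1, (- (2%:R * A 0 0)^-1); field; rewrite ?n2 ?na.
pose P : 'M[F]_2 := mx2 x y (x * A 0 0 + y * A 1 0) (x * A 0 1 + y * A 1 1).
have dP : \det P = 1 by rewrite det2E !mxE /= A11 -Q; ring.
have [g SLg Pg] := GL_lift dP; exists g; rewrite // Pg.
apply: eq_mx2; rewrite !mulmx2E !mxE /= ?A11.
- by ring.
- by ring.
- by apply: (lin1 (k := - x) du); ring.
- by apply: (lin1 (k := - y) du); ring.
Qed.

Lemma commute_squares_scalar (F : fieldType) (C : 'M[F]_2) :
    2%:R != 0 :> F ->
    (forall A : 'M_2, \det A = 1 -> C *m (A *m A) = A *m A *m C) ->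
  is_scalar_mx C.
Proof.
move=> n2 cA; have eU := cA (mx2 1 1 0 1); have eL := cA (mx2 1 0 1 1).
rewrite !det2E !mxE /= !(mulr0, mul0r, mulr1, subr0) in eU eL.
have {}eU (i j : 'I_2) := congr1 (fun A : 'M[F]_2 => A i j) (eU erefl).
have {}eL (i j : 'I_2) := congr1 (fun A : 'M[F]_2 => A i j) (eL erefl).
have c0 := eU 0 0; have d0 := eU 0 1; have b0 := eL 0 0.
rewrite !(mulmx2E, mxE) /= in c0 d0 b0.
rewrite scalar_mx2E; apply/and3P; split; apply/eqP; apply: (mulfI n2).
- by apply: (lin1 (k := 1) b0); ring.
- by apply: (lin1 (k := -1) c0); ring.
- by apply: (lin1 (k := 1) d0); ring.
Qed.

Definition square_central (F : finFieldType) (u : GL2 F) :=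
  is_scalar_mx (GLval u) || (\tr (GLval u) == 0).

(** Two elements of order at most 2 modulo the centre normalise the subgroup
    generated by their product [c], and the square of an element inverting or
    centralising [c] centralises [c]. *)
Lemma square_central_proper (F : finFieldType) (u w : GL2 F) :
    2%:R != 0 :> F -> u \in SL2 F -> w \in SL2 F ->
    square_central u -> square_central w ->
  ~~ (SL2 F \subset <<[set u; w] :|: 'Z(SL2 F)>>).
Proof.
move=> n2 SLu SLw su sw; apply/negP => sH.
have SLc : (u * w)%g \in SL2 F by apply: groupM.
set c := (u * w)%g in SLc.
have cH (K : {group GL2 F}) : u \in K -> w \in K -> 'Z(SL2 F) \subset K -> SL2 F \subset K.
  move=> Ku Kw KZ; apply: subset_trans sH _; rewrite gen_subG subUset KZ andbT.
  by apply/subsetP=> z /set2P[]->.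
have inv (z : GL2 F) : z \in SL2 F -> \tr (GLval z) = 0 -> GLval z^-1%g = - GLval z.
  by move=> SLz tz; rewrite SL2_inverse // tz raddf0 sub0r.
have NcZ : 'Z(SL2 F) \subset 'N([set c; c^-1%g]).
  apply: subset_trans (subsetIr _ _) _.
  apply: subset_trans (centS (_ : [set c; c^-1%g] \subset SL2 F)) (cent_sub _).
  by apply/subsetP=> z /set2P[]->; rewrite ?groupV.
have Nmem g : (c ^ g)%g \in [set c; c^-1%g] -> g \in 'N([set c; c^-1%g]).
  move=> cg; rewrite inE; apply/subsetP=> _ /imsetP[z /set2P[]-> ->] //.
  by move: cg; rewrite conjVg !inE => /orP[]/eqP->; rewrite ?invgK eqxx ?orbT.
have cuw : GLval u *m GLval w = GLval w *m GLval u \/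
    \tr (GLval u) = 0 /\ \tr (GLval w) = 0.
  move: su sw => /orP[su _|/eqP tu /orP[sw|/eqP tw]]; last by right.
    by left; apply: scalar_commute.
  by left; rewrite (scalar_commute (GLval u) sw).
have cJ : (c ^ u)%g = (w * u)%g /\ (c ^ w)%g = (w^-1 * u * (w * w))%g.
  by rewrite !conjgE /c !mulgA mulVg mul1g.
have NH : SL2 F \subset 'N([set c; c^-1%g]).
  have [/GL_commute e | [tu tw]] := cuw.
    by apply: cH => //; apply: Nmem; rewrite !inE; apply/orP; left; apply/eqP;
      apply/conjg_fixP/commgP; rewrite /c;
      [apply: commute_sym; apply: commuteM | apply: commute_sym; apply: commuteM].
  have cV : (c^-1 = w * u)%g.
    apply: GL2_inj; rewrite invMg !GL2_M (inv u) // (inv w) //.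
    by rewrite mulmxN mulNmx opprK.
  have ww : GLval (w * w)%g = - 1%:M.
    by rewrite GL2_M sqr_mx2 tw scale0r sub0r; move: SLw; rewrite SL2P => /eqP->.
  apply: cH => //; apply: Nmem; rewrite !inE; apply/orP; right; apply/eqP.
    by rewrite cV; case: cJ.
  rewrite cV; case: cJ => _ ->; apply: GL2_inj.
  by rewrite [LHS]GL2_M ww !GL2_M (inv w) // mulmxN mulmx1 mulNmx opprK.
have sqc g : g \in SL2 F -> commute c (g * g)%g.
  move=> SLg; apply/commgP/conjg_fixP; rewrite conjgM.
  have : (c ^ g)%g \in [set c; c^-1%g] by rewrite memJ_norm ?set21 // (subsetP NH).
  by case/set2P=> e; rewrite e ?conjVg e ?invgK.
have sc : is_scalar_mx (GLval c).
  have cA (A : 'M[F]_2) : \det A = 1 -> GLval c *m (A *m A) = A *m A *m GLval c.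
    by move=> dA; have [g SLg <-] := GL_lift dA; rewrite -GL2_M; apply/GL_commute/sqc.
  exact: commute_squares_scalar n2 cA.
have cuw' : commute u w.
  apply/GL_commute; have := scalar_commute (GLval u) sc; rewrite GL2_M => e.
  by apply: (can_inj (mulKmx (GL2_unitmx u))); rewrite /= -e mulmxA.
have in_center z : z \in SL2 F -> u \in 'C[z]%g -> w \in 'C[z]%g -> z \in 'Z(SL2 F)%g.
  move=> SLz uz wz; apply/setIP; split=> //; rewrite -sub1set centsC cent_set1.
  apply: (cH 'C[z]%G) => //; apply: subset_trans (subsetIr _ _) _.
  by rewrite /= -(cent_set1 z) centS ?sub1set.
have Zu : u \in 'Z(SL2 F)%g by apply: in_center; rewrite ?cent1id //; apply/cent1P/commute_sym.
have Zw : w \in 'Z(SL2 F)%g by apply: in_center; rewrite ?cent1id //; apply/cent1P.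
have sZ : SL2 F \subset 'Z(SL2 F)%g by apply: cH.
have d1 : \det (mx2 1 1 0 1 : 'M[F]_2) = 1 by rewrite det2E !mxE /=; ring.
have [t SLt et] := GL_lift d1.
have := subsetP sZ _ SLt; rewrite center_SL2 // et scalar_mx2E !mxE /=.
by rewrite oner_eq0.
Qed.

(** * Cocliques and their lifts to SL2 *)

(** A proper subgroup is a coclique, so [A] is any maximal subgroup above [M]. *)
Lemma maximal_coclique_sub_proper (gT : finGroupType) (G M : {group gT}) (A : {set gT}) :
  maximal_coclique G A -> A \subset M -> M \proper G -> maximal A G.
Proof.
move=> [_ maxA] sAM pMG; have [eMG | [K maxK sMK]] := maximal_exists (proper_sub pMG).
  by move: pMG; rewrite eMG properxx.
suff -> : A = K by [].
have pKG := maxgroupp maxK; apply: maxA; last exact: subset_trans sMK.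
  split; first exact: proper_sub.
  move=> g h Kg Kh e; have : G \subset K.
    by rewrite -e gen_subG; apply/subsetP=> x /set2P[]->.
  by apply/negP; have /andP[] := pKG.
Qed.

Lemma norm_center_SL2 (F : finFieldType) : SL2 F \subset 'N('Z(SL2 F))%g.
Proof. by rewrite normal_norm // center_normal. Qed.

Definition SL2_lift (F : finFieldType) (A : {set coset_of 'Z(SL2 F)}) : {set GL2 F} :=
  [set u in SL2 F | coset 'Z(SL2 F) u \in A].

Lemma PSL2_lift (F : finFieldType) (a : coset_of 'Z(SL2 F)) : a \in PSL2 F ->
  exists2 u : GL2 F, u \in SL2 F & coset 'Z(SL2 F) u = a.
Proof. by case/morphimP=> u _ SLu ->; exists u. Qed.

Lemma PSL2_pairP (F : finFieldType) (u w : GL2 F) : u \in SL2 F -> w \in SL2 F ->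
  <<[set coset 'Z(SL2 F) u; coset 'Z(SL2 F) w]>>%g = PSL2 F
    <-> SL2 F \subset <<[set u; w] :|: 'Z(SL2 F)>>%g.
Proof.
move=> SLu SLw; pose Z := 'Z(SL2 F)%G.
pose K := <<[set coset Z u; coset Z w]>>%G.
have nZ := norm_center_SL2 F.
have sKG : K \subset PSL2 F.
  by rewrite gen_subG; apply/subsetP=> x /set2P[]->; apply: mem_quotient.
pose H := <<[set u; w] :|: Z>>%G.
have sZH : Z \subset H by rewrite sub_gen // subsetUr.
have Hu : u \in H by rewrite mem_gen // !inE eqxx.
have Hw : w \in H by rewrite mem_gen // !inE eqxx orbT.
split=> [|sH]; last first.
  apply/eqP; rewrite eqEsubset; apply/andP; split; first exact: sKG.
  suff : (SL2 F / Z \subset (coset Z @*^-1 K) / Z)%g by rewrite cosetpreK.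
  apply: quotientS; apply: subset_trans sH _.
  rewrite gen_subG subUset sub_cosetpre andbT.
  by apply/subsetP=> x /set2P[]->; apply/morphpreP; split;
    rewrite ?(subsetP nZ) ?mem_gen // !inE eqxx ?orbT.
rewrite -[<<_>>]/(gval K) => eK; rewrite -[<<_>>]/(gval H) -(quotientSGK nZ sZH).
suff sKH : (K \subset H / Z)%g by rewrite eK in sKH.
rewrite gen_subG.
by apply/subsetP=> x /set2P[]->; apply: mem_quotient.
Qed.

Lemma lift_pair_proper (F : finFieldType) (A : {set coset_of 'Z(SL2 F)}) (u w : GL2 F) :
    coclique (PSL2 F) A -> u \in SL2_lift A -> w \in SL2_lift A ->
  ~~ (SL2 F \subset <<[set u; w] :|: 'Z(SL2 F)>>%g).
Proof.
move=> [_ cA] /setIdP[SLu Au] /setIdP[SLw Aw]; apply/negP => s.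
by case: (cA _ _ Au Aw); apply/PSL2_pairP.
Qed.

Lemma card_lift (F : finFieldType) (A : {set coset_of 'Z(SL2 F)}) :
    2%:R != 0 :> F -> A \subset PSL2 F ->
  (#|A| * 2 <= #|[set GLval u | u in SL2_lift A]|)%N.
Proof.
move=> n2 sA; rewrite card_imset; last exact: GL2_inj.
apply: (card_ge_fibers (f := coset 'Z(SL2 F))) => [u /setIdP[] // | a Aa].
have [u SLu ua] := PSL2_lift (subsetP sA a Aa).
have d1 : \det (- 1%:M : 'M[F]_2) = 1 by rewrite det2E !mxE /=; ring.
have [z SLz ez] := GL_lift d1.
have Zz : z \in 'Z(SL2 F)%g.
  by rewrite center_SL2 // ez -raddfN /= scalar_mx_is_scalar.
have nzu : (z * u)%g != u.
  apply: contraNneq n2 => /(congr1 (fun w : GL2 F => GLval (w * u^-1)%g)).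
  rewrite mulgK mulgV ez GL2_1 => /(congr1 (fun B : 'M[F]_2 => B 0 0)).
  by rewrite !mxE /= => e; apply/eqP; apply: (lin1 (k := -1) e); ring.
have nZ := norm_center_SL2 F.
have nZu := subsetP nZ u SLu; have nZz := subsetP nZ z SLz.
apply: (@leq_trans #|[set (z * u)%g; u]|); first by rewrite cards2 nzu.
apply: subset_leq_card; apply/subsetP=> _ /set2P[]->.
  have zua : coset 'Z(SL2 F) (z * u)%g = a by rewrite coset_kerl.
  by apply/setIdP; rewrite zua eqxx; split=> //; apply/setIdP; rewrite zua groupM.
by apply/setIdP; rewrite ua eqxx; split=> //; apply/setIdP; rewrite ua.
Qed.

Lemma borel_maximal (F : finFieldType) (A : {set coset_of 'Z(SL2 F)}) (v : 'rV[F]_2) :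
    maximal_coclique (PSL2 F) A -> v != 0 ->
    {in SL2_lift A, forall u : GL2 F, stablemx v (GLval u)} ->
  maximal A (PSL2 F).
Proof.
move=> mA nzv vA; pose B0 : {set GL2 F} := [set u in SL2 F | stablemx v (GLval u)].
have gB : group_set B0.
  apply/group_setP; split=> [|x y]; first by rewrite inE group1 GL2_1 mulmx1 submx_refl.
  move=> /setIdP[SLx vx] /setIdP[SLy vy]; rewrite inE groupM // GL2_M.
  by rewrite stablemxM.
pose B := Group gB; have nZ := norm_center_SL2 F.
have sB : B \subset SL2 F by apply/subsetP=> x /setIdP[].
have sZB : 'Z(SL2 F)%g \subset B.
  apply/subsetP=> z Zz; have SLz := subsetP (center_sub _) z Zz.
  rewrite inE SLz; move: Zz; rewrite center_SL2 // => /is_scalar_mxP[a ->].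
  exact: stablemxC.
have nsB : ~~ (SL2 F \subset B).
  have [s ds vs] : exists2 s : 'M[F]_2, \det s = 1 & ~~ stablemx v s.
    move: (nzv); rewrite rV2_neq0 => /orP[v0|v1].
      exists (mx2 1 1 0 1); first by rewrite det2E !mxE /=; ring.
      apply/negP => /(rV2_colinearP _ nzv); rewrite !mulmx2E !mxE /= => e.
      have /eqP : v 0 0 * v 0 0 = 0 by apply: (lin1 (k := 1) e); ring.
      by rewrite mulf_eq0 (negPf v0).
    exists (mx2 1 0 1 1); first by rewrite det2E !mxE /=; ring.
    apply/negP => /(rV2_colinearP _ nzv); rewrite !mulmx2E !mxE /= => e.
    have /eqP : v 0 1 * v 0 1 = 0 by apply: (lin1 (k := -1) e); ring.
    by rewrite mulf_eq0 (negPf v1).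
  have [g SLg eg] := GL_lift ds; apply/subsetPn; exists g => //.
  by rewrite inE SLg eg (negPf vs).
have [[sA _] _] := mA.
apply: (maximal_coclique_sub_proper (M := (B / 'Z(SL2 F))%G) mA).
  apply/subsetP=> a Aa; have [u SLu ua] := PSL2_lift (subsetP sA a Aa).
  by rewrite -ua mem_quotient // inE SLu vA // inE SLu ua.
rewrite properE; apply/andP; split; first exact: quotientS.
suff : ~~ (SL2 F / 'Z(SL2 F) \subset B / 'Z(SL2 F))%g by [].
by rewrite quotientSGK.
Qed.

Lemma coset_eq1_SL2 (F : finFieldType) (u : GL2 F) : u \in SL2 F ->
  (coset 'Z(SL2 F) u == 1%g) = is_scalar_mx (GLval u).
Proof.
move=> SLu; rewrite -center_SL2 //; apply/eqP/idP => [|Zu]; last exact: coset_id.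
by apply: coset_idr; apply: (subsetP (norm_center_SL2 F)).
Qed.

Lemma PSL2_order2 (F : finFieldType) (u : GL2 F) : 2%:R != 0 :> F -> u \in SL2 F ->
  (#[coset 'Z(SL2 F) u]%g == 2%N) = ~~ is_scalar_mx (GLval u) && (\tr (GLval u) == 0).
Proof.
move=> n2 SLu; have nZu := subsetP (norm_center_SL2 F) u SLu.
have uu : coset 'Z(SL2 F) (u ^+ 2)%g = (coset 'Z(SL2 F) u ^+ 2)%g by rewrite morphX.
have SLuu : (u ^+ 2)%g \in SL2 F by apply: groupX.
have e2 : GLval (u ^+ 2)%g = \tr (GLval u) *: GLval u + (-1)%:M.
  rewrite GL2_X expr2 [LHS]sqr_mx2; move: SLu; rewrite SL2P => /eqP->.
  by rewrite raddfN.
apply/idP/andP => [/eqP o2 | [nsu /eqP tu]].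
  have nsu : ~~ is_scalar_mx (GLval u).
    by rewrite -coset_eq1_SL2 // -order_eq1 o2.
  split=> //; apply/eqP; apply: (scalar_affine (y := -1) nsu).
  rewrite -e2 -coset_eq1_SL2 // uu.
  by have := expg_order (coset 'Z(SL2 F) u); rewrite o2 => ->.
apply/eqP; apply: nt_prime_order => //.
  by apply/eqP; rewrite -uu coset_eq1_SL2 // e2 tu scale0r add0r scalar_mx_is_scalar.
by rewrite coset_eq1_SL2.
Qed.

(** * Cocliques of involutions *)

Lemma square_centralE (F : finFieldType) (u : GL2 F) : 2%:R != 0 :> F -> u \in SL2 F ->
  square_central u =
    (coset 'Z(SL2 F) u == 1%g) || (#[coset 'Z(SL2 F) u]%g == 2%N).
Proof.
move=> n2 SLu; rewrite coset_eq1_SL2 // PSL2_order2 // /square_central.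
by case: (is_scalar_mx _).
Qed.

Lemma PSL2_involutions_class (F : finFieldType) : 2%:R != 0 :> F -> odd #|F| ->
  [set x in PSL2 F | #[x]%g == 2%N] \in classes (PSL2 F).
Proof.
move=> n2 oddF; have d1 : \det (mx2 0 1 (-1) 0 : 'M[F]_2) = 1.
  by rewrite det2E !mxE /=; ring.
have [t SLt et] := GL_lift d1; have nZ := norm_center_SL2 F.
have Gt : coset 'Z(SL2 F) t \in PSL2 F by apply: mem_quotient.
have o2 : #[coset 'Z(SL2 F) t]%g == 2%N.
  rewrite PSL2_order2 // et scalar_mx2E mxtrace2E !mxE /=.
  by rewrite oner_eq0 addr0 eqxx.
apply/imsetP; exists (coset 'Z(SL2 F) t) => //.
apply/setP=> a; apply/setIdP/imsetP => [[Ga oa] | [g Gg ->]]; last first.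
  by rewrite groupJ // orderJ.
have [u SLu ua] := PSL2_lift Ga.
move: oa; rewrite -ua PSL2_order2 // => /andP[_ /eqP tu].
have [g SLg eg] := trace0_conj oddF n2 SLu tu.
exists (coset 'Z(SL2 F) g); first exact: mem_quotient.
rewrite -morphJ ?(subsetP nZ) //; congr (coset _ _); apply: GL2_inj.
by rewrite GL2_J et -mulmxA -eg mulKmx ?GL2_unitmx.
Qed.

(** The identity and the involutions together form a coclique, because two
    involutions generate a proper subgroup. *)
Lemma square_central_coclique (F : finFieldType) (A : {set coset_of 'Z(SL2 F)}) :
    2%:R != 0 :> F -> odd #|F| -> maximal_coclique (PSL2 F) A ->
    {in SL2_lift A, forall u : GL2 F, square_central u} ->
  A :\ 1%g \in classes (PSL2 F) /\ A :\ 1%g = [set x in PSL2 F | #[x]%g == 2%N].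
Proof.
move=> n2 oddF [[sA cA] maxA] sqA.
pose B := [set x in PSL2 F | (x == 1%g) || (#[x]%g == 2%N)].
suff eI : A :\ 1%g = [set x in PSL2 F | #[x]%g == 2%N].
  by split=> //; rewrite eI PSL2_involutions_class.
have -> : A = B.
  apply: maxA.
    split=> [|x y /setIdP[Gx ox] /setIdP[Gy oy]]; first by apply/subsetP=> x /setIdP[].
    have [u SLu ux] := PSL2_lift Gx; have [w SLw wy] := PSL2_lift Gy.
    rewrite -ux -wy => /(PSL2_pairP SLu SLw); apply/negP.
    by apply: square_central_proper; rewrite ?square_centralE ?ux ?wy.
  apply/subsetP=> a Aa; have Ga := subsetP sA a Aa; have [u SLu ua] := PSL2_lift Ga.
  apply/setIdP; split=> //; rewrite -ua -square_centralE // sqA //.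
  by apply/setIdP; rewrite ua.
apply/setP=> x; rewrite in_setD1; apply/andP/setIdP => [[nx /setIdP[Gx]] | [Gx ox]].
  by rewrite (negPf nx).
split; last by apply/setIdP; rewrite ox orbT.
by apply: contraTneq ox => ->; rewrite order1.
Qed.

Lemma coclique_linked_family (p : nat) (A : {set coset_of 'Z(SL2 'F_p)}) :
    prime p -> (2 < p)%N -> coclique (PSL2 'F_p) A ->
    {in SL2_lift A, forall u : GL2 'F_p,
      ~~ is_scalar_mx (GLval u) -> \tr (GLval u) ^+ 2 != 4%:R} ->
  linked_family [set GLval u | u in SL2_lift A].
Proof.
move=> pp p2 cA npA; split=> [_ /imsetP[u /setIdP[SLu _] ->] | _ /imsetP[u Lu ->] |].
- by apply/eqP; rewrite -SL2P.
- exact: npA.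
move=> _ _ /imsetP[u Lu ->] /imsetP[w Lw ->] tu.
have [SLu _] := setIdP Lu; have [SLw _] := setIdP Lw.
exact: proper_pair_linked pp p2 SLu SLw (lift_pair_proper cA Lu Lw) tu.
Qed.

(** * The bound *)

(** The second eigenvalue is [b = \tr Z - a], and by Cayley-Hamilton the rows of
    [Z - a] are eigenvectors for it. *)
Lemma diagonal_basis (F : finFieldType) (Z : 'M[F]_2) (v : 'rV[F]_2) :
    \det Z = 1 -> ~~ is_scalar_mx Z -> \tr Z ^+ 2 != 4%:R -> v != 0 -> stablemx v Z ->
  exists P : 'M[F]_2, [/\ P \in unitmx, (P *m Z *m invmx P) 0 1 = 0,
    (P *m Z *m invmx P) 1 0 = 0
    & (P *m Z *m invmx P) 0 0 != (P *m Z *m invmx P) 1 1].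
Proof.
move=> dZ nsZ ntZ nzv /sub_rVP[a va].
set b := \tr Z - a.
have ZZ : (Z - a%:M) *m (Z - b%:M) = (a * b - 1)%:M.
  rewrite mulmxBl mulmxBr sqr_mx2 dZ mul_mx_scalar mul_scalar_mx scalerBr scale_scalar_mx.
  by apply: eq_mx2; rewrite !mxE /b /= ?mulr1n ?mulr0n; ring.
have ab : a * b = 1.
  have : v *m ((Z - a%:M) *m (Z - b%:M)) = 0.
    by rewrite mulmxA (mulmxBr v) va mul_mx_scalar subrr mul0mx.
  rewrite ZZ mul_mx_scalar => /eqP; rewrite scaler_eq0 (negPf nzv) orbF subr_eq0.
  by move/eqP.
have nab : a != b.
  apply: contraNneq ntZ => eab; apply/eqP.
  have -> : \tr Z = a + b by rewrite /b addrC subrK.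
  by apply: (lin2 (k := a - b) (k' := 4%:R) eab ab); ring.
have [w nzw wb] : exists2 w : 'rV_2, w != 0 & w *m Z = b *: w.
  have nzN : Z - a%:M != 0.
    apply: contraNneq nsZ => /eqP; rewrite subr_eq0 => /eqP->.
    exact: scalar_mx_is_scalar.
  have /rowV0Pn[w wN nzw] := nzN; exists w => //.
  have [c ->] := submxP wN; apply/eqP; rewrite -subr_eq0 -mul_mx_scalar -mulmxBr.
  by rewrite -mulmxA ZZ ab subrr raddf0 mulmx0.
have nvw : ~~ (w <= v)%MS.
  apply: contra nab => /sub_rVP[c ew]; move: wb; rewrite ew -scalemxAl va !scalerA => /eqP.
  rewrite -subr_eq0 -scalerBl scaler_eq0 (negPf nzv) orbF (mulrC b) -mulrBr mulf_eq0 subr_eq0.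
  by move: nzw; rewrite ew scaler_eq0 negb_or => /andP[/negPf->].
pose P := mx2 (v 0 0) (v 0 1) (w 0 0) (w 0 1).
have uP : P \in unitmx by apply: det_col_rV2.
exists P; have -> : P *m Z *m invmx P = mx2 a 0 0 b.
  have -> : P *m Z = mx2 a 0 0 b *m P.
    have v0 := congr1 (fun x : 'rV[F]_2 => x 0 0) va.
    have v1 := congr1 (fun x : 'rV[F]_2 => x 0 1) va.
    have w0 := congr1 (fun x : 'rV[F]_2 => x 0 0) wb.
    have w1 := congr1 (fun x : 'rV[F]_2 => x 0 1) wb.
    rewrite /= !mulmx2E !mxE in v0 v1 w0 w1.
    by apply: eq_mx2; rewrite !(mulmx2E, mxE) /= ?v0 ?v1 ?w0 ?w1; ring.
  by rewrite mulmxK.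
by rewrite !mxE /=.
Qed.

Lemma row_unitmx_neq0 (F : fieldType) (P : 'M[F]_2) i : P \in unitmx -> row i P != 0.
Proof.
apply: contraTneq => r0; apply/negP => uP.
have : row i (P *m invmx P) = 0 by rewrite row_mul r0 mul0mx.
by rewrite mulmxV // => /rowP/(_ i)/eqP; rewrite !mxE eqxx oner_eq0.
Qed.

Lemma conj_row_stable (F : fieldType) (P X : 'M[F]_2) i : P \in unitmx ->
  (forall j, j != i -> (P *m X *m invmx P) i j = 0) -> stablemx (row i P) X.
Proof.
move=> uP; have PX : P *m X = P *m X *m invmx P *m P by rewrite mulmxKV.
move: (P *m X *m invmx P) PX => M PX Mi0.
have e : row i M = M i i *: row i 1%:M.
  apply/rowP=> j; rewrite !mxE.
  have [->|nj] := eqVneq j i; first by rewrite mulr1.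
  by rewrite Mi0 // mulr0.
apply/sub_rVP; exists (M i i).
by rewrite -row_mul PX row_mul e -scalemxAl -row_mul mul1mx.
Qed.

(** The field is abstract because closed rational numerals of this size are
    expensive to evaluate. *)
Lemma half_bound (R : realFieldType) (a p : nat) :
    (0 < p)%N -> (a * 2 <= 129 * (p - 1) + 4)%N ->
  a%:R <= 129%:R / 2%:R * (p%:R - 1) + 2%:R :> R.
Proof.
case: p => // q _; rewrite subSS subn0 => le.
have : a%:R * 2%:R <= 129%:R * q%:R + 4%:R :> R.
  by rewrite -!natrM -natrD Num.Theory.ler_nat.
by rewrite -(natr1 q); lra.
Qed.

Local Close Scope ring_scope.

Lemma hyperbolic_arith (s p : nat) :
  s <= 9 -> ((s ^ 2 + 43) * (p - 1) <= 129 * (p - 1) + 4)%N.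
Proof. by rewrite -leq_sqr => s9; move: (s ^ 2)%N s9 => m s9; nia. Qed.

(** The bound [s <= p] on the number of special traces takes over from [s <= 9] when
    p is 3 or 5. *)
Lemma elliptic_arith (s p : nat) : s <= 9 -> s <= p -> 2 < p ->
  ((s ^ 2 + 1) * (p + 2) <= 129 * (p - 1) + 4)%N.
Proof.
move=> s9 sp p2; have [p7 | p6] := leqP 7 p.
  by move: s9; rewrite -leq_sqr; move: (s ^ 2)%N => m s9; nia.
move: sp; rewrite -leq_sqr; move: (s ^ 2)%N => m.
by case: p p2 p6 => [|[|[|[|[|[|[|p]]]]]]] // _ _; lia.
Qed.

Theorem theorem1 (p : nat) (p_prime : prime p) (p_gt2 : 2 < p)
    (A : {set coset_of 'Z(SL2 'F_p)}) :
  let G := PSL2 'F_p in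
  maximal_coclique G A ->
  [\/ maximal A G,
      A :\ 1 \in classes G /\ A :\ 1 = [set x in G | #[x] == 2]
    | (#|A|%:R <= 129%:R / 2%:R * (p%:R - 1) + 2%:R :> rat)%R].
Proof.
move=> G mA; have cF : #|'F_p| = p by apply: card_Fp.
have n2 : (2%:R != 0 :> 'F_p)%R by rewrite -(dvdn_pcharf (pchar_Fp p_prime)) gtnNdvd.
have oddF : odd #|'F_p| by rewrite cF; case: (even_prime p_prime) p_gt2 => [->|].
have [[sA cA] maxA] := mA; pose E := [set GLval u | u in SL2_lift A].
have rat_bound : (#|A| * 2 <= 129 * (p - 1) + 4)%N ->
    (#|A|%:R <= 129%:R / 2%:R * (p%:R - 1) + 2%:R :> rat)%R.
  by apply: half_bound; apply: prime_gt0.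
have bound : (#|E| <= 129 * (p - 1) + 4)%N -> (#|A| * 2 <= 129 * (p - 1) + 4)%N.
  by apply: leq_trans; apply: card_lift.
(* An element of order p in [A] confines [A] to the Borel subgroup fixing its
   eigenline. *)
have [/exists_inP[u Lu /andP[nsu /eqP tu]] | npA] := boolP [exists u in SL2_lift A,
    ~~ is_scalar_mx (GLval u) && (\tr (GLval u) ^+ 2 == 4%:R)%R].
  constructor 1; have [SLu _] := setIdP Lu; have du := SLu; rewrite SL2P in du.
  have [v nzv vu] := parabolic_eigenline n2 (eqP du) tu.
  apply: (borel_maximal mA nzv) => w Lw.
  apply: contraNT (lift_pair_proper (conj sA cA) Lu Lw) => vw.
  apply: (@parabolic_generation p <<[set u; w] :|: 'Z(SL2 'F_p)>> u w v) => //;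
    rewrite ?(eqP du) // mem_gen // !inE eqxx ?orbT //.
have {}npA : {in SL2_lift A, forall u : GL2 'F_p,
    ~~ is_scalar_mx (GLval u) -> (\tr (GLval u) ^+ 2 != 4%:R)%R}.
  move=> u Lu nsu; apply: contra npA => tu.
  by apply/exists_inP; exists u; rewrite ?nsu.
have fE : linked_family E by apply: coclique_linked_family.
have [allsq | /forall_inPn[u Lu]] := boolP [forall u in SL2_lift A, square_central u].
  constructor 2; apply: square_central_coclique => // u Lu.
  exact: (forall_inP allsq).
rewrite negb_or => /andP[nsu tu].
set Z := GLval u in nsu tu.
have EZ : Z \in E by apply: imset_f.
have [dE _ lE] := fE; have dZ := dE _ EZ.
have [/existsP[v /andP[nzv vZ]] | ell] :=
  boolP [exists v : 'rV_2, (v != 0%R) && stablemx v Z].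
  have [P [uP Z01 Z10 nZ]] := diagonal_basis dZ nsu (npA u Lu nsu) nzv vZ.
  pose c X := (P *m X *m invmx P)%R.
  have injc : injective c.
    by move=> X Y /(can_inj (mulmxK _)); rewrite unitmx_inv => /(_ uP)/(can_inj (mulKmx uP)).
  have fcE := linked_family_conj uP fE.
  have EcZ : c Z \in c @: E by apply: imset_f.
  have tcZ : (\tr (c Z) != 0)%R by rewrite /c mxtrace_mulC mulKmx.
  have lowP (w : GL2 'F_p) : w \in SL2_lift A -> c (GLval w) \in c @: E.
    by move=> Lw; do 2!apply: imset_f.
  have [/exists_inP[Y1 EY1 nY1] | low] :=
    boolP [exists Y in c @: E, Y 0%R 1%R != 0%R]; last first.
    constructor 1; apply: (borel_maximal mA (row_unitmx_neq0 0%R uP)) => w Lw.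
    apply: conj_row_stable => // j nj; apply/eqP; apply: contraNT low.
    case: (ord2P j) nj => -> // _ nz.
    by apply/exists_inP; exists (c (GLval w)); rewrite ?lowP.
  have [/exists_inP[Y2 EY2 nY2] | up] :=
    boolP [exists Y in c @: E, Y 1%R 0%R != 0%R]; last first.
    constructor 1; apply: (borel_maximal mA (row_unitmx_neq0 1%R uP)) => w Lw.
    apply: conj_row_stable => // j nj; apply/eqP; apply: contraNT up.
    case: (ord2P j) nj => -> // _ nz.
    by apply/exists_inP; exists (c (GLval w)); rewrite ?lowP.
  constructor 3; apply/rat_bound/bound.
  have := card_hyperbolic_linked fcE EcZ Z01 Z10 nZ tcZ EY1 nY1 EY2 nY2.
  rewrite (card_imset _ injc) cF => le; apply: leq_trans le _.
  by rewrite -subn1; apply: hyperbolic_arith; apply: card_special_trace.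
constructor 3; apply/rat_bound/bound.
have ell' (v : 'rV_2) : (v != 0)%R -> ~~ stablemx v Z.
  by move=> nzv; apply: contra ell => vZ; apply/existsP; exists v; rewrite nzv.
have := card_elliptic_linked ell' dE (fun Y EY => lE Z Y EZ EY tu).
rewrite cF => le; apply: leq_trans le _.
apply: elliptic_arith => //; first exact: card_special_trace.
by rewrite -[leqRHS]cF max_card.
Qed.
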